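(* Let $X$ be a compact ergodic nilspace. Then there is a tower of surjective fibrations $$X\to\cdots\to\tau_2X\to\tau_1X\to\tau_0X$$ such that each $\tau_nX$ ($n\ge 0$) is a compact $n$-step nilspace and, for every $n\ge 1$ (and base point $x_0\in X$), the compact group $\pi_n(X,x_0)$ acts freely on $\tau_nX$ such that the orbits are exactly the fibers of the quotient map $\tau_nX\to\tau_{n-1}X$.
   Context: The cube category $\Box$ has objects $\{0,1\}^n$ ($n\in\mathbb N_0$); morphisms are the maps $\{0,1\}^n\to\{0,1\}^m$ that are restrictions of affine linear maps $\mathbb Z^n\to\mathbb Z^m$. A cubeset is a presheaf of sets $X$ on $\Box$; write $X(n)$ for its value on $\{0,1\}^n$ (the $n$-cubes) and $\Box^n$ for the presheaf represented by $\{0,1\}^n$. For $n\ge1$ and $1\le i\le n$, $\varepsilon_i\colon\{0,1\}^{n-1}\to\{0,1\}^n$ inserts a $0$ at coordinate $i$; the corner $\Lambda^n\subseteq\Box^n$ is the union of the images of the $\varepsilon_i\colon\Box^{n-1}\to\Box^n$. A cubeset $X$ is concrete if for all $n$ the vertex map $X(n)\to X(0)^{\{0,1\}^n}$ is injective; a map $X\to Y$ is a fibration if it has the right lifting property against all inclusions $\Lambda^n\to\Box^n$, $n\ge1$; $X$ is fibrant if $X\to *$ is a fibration; $X$ is $N$-step ($N\ge 0$) if restriction $\mathrm{Hom}(\Box^k,X)\to\mathrm{Hom}(\Lambda^k,X)$ is bijective for all $k>N$. The truncation $\tau_n$ is the left adjoint of the inclusion of $n$-step cubesets into cubesets. $X$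 is ergodic if $\tau_0X=*$. A nilspace is a concrete fibrant cubeset which is $N$-step for some $N\in\mathbb N$; it is notationally identified with its set of points $X(0)$, its $n$-cubes forming a subset of $X^{2^n}$. For a concrete fibrant cubeset $X$, $\tau_nX$ is the quotient with point set $X(0)/\!\sim_n$, where $x\sim_n y$ iff there are $c,c'\in X(n+1)$ with equal restriction to $\Lambda^{n+1}$ and with values $x$, resp. $y$, at the vertex $(1,\dots,1)$; its $m$-cubes are the images of the $m$-cubes of $X$. ''Compact'' space means compact second-countable Hausdorff space. A compact nilspace is a nilspace $X$ such that $X=X(0)$ is a compact space and all $X(n)\subseteq X^{2^n}$ are closed. Morphisms (in particular the maps of the tower) are continuous; $\tau_nX$ carries the quotient topology. For $n\ge1$ and $x_0\in X$, the group $\pi_n(X,x_0)$ is the set of all $c\in(\tau_nX)(n)$ whose restriction to $\Lambda^n$ is constant equal to (the image of) $x_0$, topologized as a closed subspace of $(\tau_nX)^{2^n}$, with the following multiplication: given $a,b$, there is a unique $d\in(\tau_nX)(n+1)$ with $d\circ\varepsilon_1=a$, $d\circ\varepsilon_2=b$, $d\circ\varepsilon_i$ constant $x_0$ for $3\le i\le n+1$; then $a*b=d\circ s$ with $s(x_1,\dots,x_n)=(x_1,x_1,x_2,\dots,x_n)$. Group actions of topological groups are continuous. *)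

(* Defs.v *)
From HB Require Import structures.
From Stdlib Require Import Relations.
From mathcomp Require Import all_boot all_order all_algebra.
From mathcomp Require Import generic_quotient.
From mathcomp Require Import all_classical all_reals topology.

Set Implicit Arguments.
Unset Strict Implicit.
Unset Printing Implicit Defensive.

Import GRing.Theory.
Local Open Scope quotient_scope.
Local Open Scope classical_set_scope.
Local Open Scope ring_scope.

(** * The cube category *)

Definition vertex (n : nat) := {ffun 'I_n -> bool}.

Definition coords (n : nat) (v : vertex n) : 'rV[int]_n := \row_i (v i)%:R.

Definition cube_morphism (m n : nat) (f : vertex m -> vertex n) : Prop :=
  exists (A : 'M[int]_(m, n)) (b : 'rV[int]_n),
    forall v, coords (f v) = coords v *m A + b.

(* For n = 0 there is no i.  Coordinates are numbered from 0. *)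
Definition eps (n : nat) (i : 'I_n) (w : vertex n.-1) : vertex n :=
  [ffun j => if unlift i j is Some k then w k else false].

Definition top_vertex (n : nat) : vertex n := [ffun=> true].

Lemma cube_morphism_cst m n (v : vertex n) :
  cube_morphism (fun _ : vertex m => v).
Proof. by exists 0, (coords v) => w; rewrite mulmx0 add0r. Qed.

Lemma cube_morphism_comp m n p (g : vertex n -> vertex p)
    (f : vertex m -> vertex n) :
  cube_morphism g -> cube_morphism f -> cube_morphism (g \o f).
Proof.
move=> [A [b gE]] [A' [b' fE]]; exists (A' *m A), (b' *m A + b) => v /=.
by rewrite gE fE mulmxDl mulmxA addrA.
Qed.

Lemma vertex0_eq (v w : vertex 0) : v = w.
Proof. by apply/ffunP; case. Qed.

(** * Cubesets *)

(* A concrete presheaf on the cube category, presented by its set of points T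
   and, for each n, its set of n-cubes as a subset of T^(2^n).  Maps between
   concrete presheaves are the maps of points that preserve cubes. *)
Record cubeset (T : Type) := Cubeset {
  cube : forall n, set (vertex n -> T);
  cube_point : forall c : vertex 0 -> T, cube c;
  cube_comp : forall m n (f : vertex m -> vertex n), cube_morphism f ->
    forall c, cube c -> cube (c \o f) }.

Arguments cube {T} _ n _.

Definition Hom (S T : Type) (C : cubeset S) (D : cubeset T) : set (S -> T) :=
  [set f : S -> T | forall n c, cube C n c -> cube D n (f \o c)].

Section Box.
Variable n : nat.

Let box_cube m : set (vertex m -> vertex n) := [set f | cube_morphism f].

Lemma box_cube_point (c : vertex 0 -> vertex n) : box_cube c.
Proof.
have -> : c = fun=> c [ffun=> false].
  by apply/funext => w; rewrite (vertex0_eq w [ffun=> false]).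
exact: cube_morphism_cst.
Qed.

Lemma box_cube_comp k m (f : vertex k -> vertex m) : cube_morphism f ->
  forall c, box_cube c -> box_cube (c \o f).
Proof. by move=> fm c cm; exact: cube_morphism_comp. Qed.

Definition Box : cubeset (vertex n) := Cubeset box_cube_point box_cube_comp.

End Box.

Definition corner (n : nat) :=
  {v : vertex n | [exists i : 'I_n, exists w : vertex n.-1, v == eps i w]}.

Section Corner.
Variable n : nat.

Let corner_cube m : set (vertex m -> corner n) :=
  [set u | exists (i : 'I_n) (g : vertex m -> vertex n.-1),
     cube_morphism g /\ forall w, val (u w) = eps i (g w)].

Lemma corner_cube_point (c : vertex 0 -> corner n) : corner_cube c.
Proof.
have /existsP[i /existsP[w /eqP cE]] := valP (c [ffun=> false]).
exists i, (fun=> w); split; first exact: cube_morphism_cst.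
by move=> w'; rewrite (vertex0_eq w' [ffun=> false]).
Qed.

Lemma corner_cube_comp k m (f : vertex k -> vertex m) : cube_morphism f ->
  forall c, corner_cube c -> corner_cube (c \o f).
Proof.
move=> fm c [i [g [gm cE]]]; exists i, (g \o f).
by split => [|w /=]; [exact: cube_morphism_comp | rewrite cE].
Qed.

Definition Corner : cubeset (corner n) :=
  Cubeset corner_cube_point corner_cube_comp.

End Corner.

Definition Terminal : cubeset unit :=
  @Cubeset unit (fun _ => setT) (fun _ => I) (fun _ _ _ _ _ _ => I).

Section CubesetNotions.
Variables (S T : Type) (C : cubeset S) (D : cubeset T).

(* Right lifting property against the inclusions Corner n -> Box n. *)
Definition fibration (f : S -> T) : Prop :=
  Hom C D f /\
  forall n, (0 < n)%N -> forall (u : corner n -> S) (v : vertex n -> T),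
    Hom (Corner n) C u -> Hom (Box n) D v -> f \o u = v \o val ->
    exists h : vertex n -> S, [/\ Hom (Box n) C h, h \o val = u & f \o h = v].

End CubesetNotions.

Definition fibrant (T : Type) (C : cubeset T) : Prop :=
  fibration C Terminal (fun=> tt).

Definition nstep (N : nat) (T : Type) (C : cubeset T) : Prop :=
  forall k, (N < k)%N ->
    set_bij (Hom (Box k) C) (Hom (Corner k) C)
      (fun h : vertex k -> T => h \o (val : corner k -> vertex k)).

Definition nilspace (T : Type) (C : cubeset T) : Prop :=
  fibrant C /\ exists N, nstep N C.

(** * Compact nilspaces *)

Definition compact_space (T : topologicalType) : Prop :=
  [/\ compact [set: T], hausdorff_space T & @second_countable T].

Definition compact_nilspace (T : topologicalType) (C : cubeset T) : Prop :=
  [/\ nilspace C, compact_space T &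
      forall n, closed (cube C n : set {ptws vertex n -> T})].

(** * Truncations *)

Definition trunc_rel (n : nat) (T : Type) (C : cubeset T) : relation T :=
  fun x y => exists c c' : vertex n.+1 -> T,
    [/\ cube C n.+1 c, cube C n.+1 c',
        forall v : corner n.+1, c (val v) = c' (val v),
        c (top_vertex n.+1) = x & c' (top_vertex n.+1) = y].

Section Truncation.
Variables (n : nat) (T : topologicalType) (C : cubeset T).

(* On a fibrant cubeset trunc_rel is already an equivalence relation; taking
   the generated equivalence makes the quotient definable for every C. *)
Definition trunc_eq : rel T :=
  fun x y => `[< clos_refl_sym_trans T (trunc_rel n C) x y >].

Lemma trunc_eq_refl : reflexive trunc_eq.
Proof. by move=> x; apply/asboolP; exact: rst_refl. Qed.

Lemma trunc_eq_sym : symmetric trunc_eq.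
Proof. by move=> x y; apply/asboolP/asboolP => ?; exact: rst_sym. Qed.

Lemma trunc_eq_trans : transitive trunc_eq.
Proof.
by move=> y x z /asboolP xy /asboolP yz; apply/asboolP/(rst_trans _ _ _ y).
Qed.

Canonical trunc_equiv := EquivRel trunc_eq
  trunc_eq_refl trunc_eq_sym trunc_eq_trans.

Definition trunc : topologicalType :=
  quotient_topology {eq_quot trunc_equiv}.

Definition trunc_proj : T -> trunc :=
  \pi_(quotient_topology {eq_quot trunc_equiv})%qT.

Let trunc_cube m : set (vertex m -> trunc) :=
  [set c | exists c0, cube C m c0 /\ c = trunc_proj \o c0].

Lemma trunc_cube_point (c : vertex 0 -> trunc) : trunc_cube c.
Proof.
exists (fun w => repr (c w : quotient_topology {eq_quot trunc_equiv})).
split; first exact: cube_point.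
by apply/funext => w; rewrite /trunc_proj /= reprK.
Qed.

Lemma trunc_cube_comp k m (f : vertex k -> vertex m) : cube_morphism f ->
  forall c, trunc_cube c -> trunc_cube (c \o f).
Proof.
by move=> fm c [c0 [cc0 ->]]; exists (c0 \o f); split => //; exact: cube_comp.
Qed.

Definition Trunc : cubeset trunc := Cubeset trunc_cube_point trunc_cube_comp.

End Truncation.

Definition ergodic (T : topologicalType) (C : cubeset T) : Prop :=
  forall m, exists! c : vertex m -> trunc 0 C, cube (Trunc 0 C) m c.

(** * Homotopy groups *)

Section Pi.
Variables (T : topologicalType) (C : cubeset T) (n : nat) (x0 : T).

Definition pi_set : set {ptws vertex n -> trunc n C} :=
  [set c | cube (Trunc n C) n c /\
           forall v : corner n, c (val v) = trunc_proj n C x0].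

(* The coercion of pi_set to a type carries the subspace topology. *)
Definition pi_space : topologicalType := pi_set.

Definition pi_val (a : pi_space) : vertex n -> trunc n C := set_val a.

Definition pi_filler (a b : pi_space) (d : vertex n.+1 -> trunc n C) : Prop :=
  cube (Trunc n C) n.+1 d /\
  forall (i : 'I_n.+1) (w : vertex n), d (eps i w) =
    if i == 0 :> nat then pi_val a w
    else if i == 1 :> nat then pi_val b w
    else trunc_proj n C x0.

End Pi.

(* (x_1, ..., x_n) |-> (x_1, x_1, x_2, ..., x_n) with n = k.+1. *)
Definition dup_first (k : nat) (v : vertex k.+1) : vertex k.+2 :=
  [ffun j : 'I_k.+2 => v (inord j.-1)].

(** * Topological groups and their actions *)

Record group_law (G : Type) := GroupLaw {
  gmul : G -> G -> G;
  gone : G;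
  ginv : G -> G;
  gmulA : associative gmul;
  gmul1l : left_id gone gmul;
  gmul1r : right_id gone gmul;
  gmulVl : left_inverse gone ginv gmul;
  gmulVr : right_inverse gone ginv gmul }.

Definition topological_group (G : topologicalType) (L : group_law G) : Prop :=
  continuous (fun gh : G * G => gmul L gh.1 gh.2) /\ continuous (ginv L).

Definition pi_group_law (T : topologicalType) (C : cubeset T) (k : nat)
    (x0 : T) (L : group_law (pi_space C k.+1 x0)) : Prop :=
  forall a b, exists d : vertex k.+2 -> trunc k.+1 C,
    unique (pi_filler a b) d /\ pi_val (gmul L a b) = d \o @dup_first k.

Definition continuous_action (G : topologicalType) (L : group_law G)
    (S : topologicalType) (act : G -> S -> S) : Prop :=
  [/\ forall s, act (gone L) s = s,
      forall g h s, act (gmul L g h) s = act g (act h s) &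
      continuous (fun gs : G * S => act gs.1 gs.2)].

Definition free_action (G : Type) (L : group_law G) (S : Type)
    (act : G -> S -> S) : Prop :=
  forall g s, act g s = s -> g = gone L.

Definition orbits_are_fibers (G S R : Type) (act : G -> S -> S)
    (p : S -> R) : Prop :=
  forall s, [set act g s | g in [set: G]] = [set t | p t = p s].

Definition surjective_fibration (S T : topologicalType) (C : cubeset S)
    (D : cubeset T) (f : S -> T) : Prop :=
  [/\ continuous f, set_surj [set: S] [set: T] f & fibration C D f].

(* Main.v *)
From HB Require Import structures.
Require Import Defs.
From mathcomp Require Import all_boot all_order all_algebra.
From mathcomp Require Import generic_quotient finmap.
From mathcomp Require Import all_classical all_reals topology.

Set Implicit Arguments.
Unset Strict Implicit.
Unset Printing Implicit Defensive.

Import GRing.Theory Defs.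
Local Open Scope quotient_scope.

(** Everything rests on one filling principle.  In a fibrant cubeset a function
    given on a lower set of vertices, and a cube on each lower face inside that
    set, extends to a cube ([fibrant_extend]); more generally such functions
    lift along surjective fibrations ([fibration_extend]).  Filling an L-shape
    and restricting to its diagonal shows that two cubes with a common facet
    can be concatenated ([cube_glue]), and repeated concatenation gives the
    replacement lemma [cube_replace]: if two cubes differ only on the face
    where the coordinates in J are all 1, then either can be exchanged for the
    other on that face, in any third cube.

    Truncations.  Replacement identifies the relation ~_n with a single
    condition: x ~_n y if and only if the (n+1)-dimensional configuration with
    y at the top vertex and x everywhere else is a cube ([trunc_relE]).  From
    this, ~_n is an equivalence relation, cubes of dimension at most n+1 are
    stable under pointwise ~_n ([cube_rel]), and in dimension above n the class
    of the top vertex depends only on the classes of the other vertices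
    ([trunc_rel_top]).  These two facts say that X -> tau_n X is a fibration and
    that tau_n X is fibrant and n-step.  They also show that the fibres of
    tau_(n+1) X -> tau_n X are the classes of ~_n on tau_(n+1) X
    ([trunc_down_eq]).

    Topology.  By [trunc_relE] and closedness of cubes, ~_n is a closed relation
    on a compact Hausdorff space, so the quotient map is closed; hence tau_n X
    is again compact, Hausdorff and second countable, and its cubes, being
    compact, are closed.

    The action.  Write Y for tau_n X.  Call [quad x y x' y'] the
    (n+1)-dimensional configuration whose first facet is (x, ..., x, y) and
    whose opposite facet is (x', ..., x', y').  When it is a cube, y' is the
    parallel transport of y when x is moved to x'.  Ergodicity makes every pair
    of points a 1-cube, so that transport from x to x' exists; it is unique
    because Y is n-step.  Transport composes both horizontally (by gluing) and
    vertically (by replacement).  An element of pi_n(X, x0) is determined by its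
    top value g, and it acts on Y by sending s to the transport of g along the
    move from x0 to s.  The two composition rules give all the group and action
    laws at once; the group multiplication defined by corner filling is the
    action of the group on itself ([cube_corner_filler]).  Freeness and
    transitivity on fibres are uniqueness and existence of transport, and
    continuity holds because the graphs of all these maps are closed. *)

(** * Morphisms of the cube category *)

Lemma cube_morphism_coord m n (f : vertex m -> vertex n) :
  (forall j, (exists b, forall v, f v j = b) \/
             (exists i b, forall v, f v j = v i (+) b)) -> cube_morphism f.
Proof.
move=> fE.
have /choice[A AE] : forall j, exists Ab : ('I_m -> int) * int,
    forall v : vertex m,
      ((f v j)%:R = \sum_i (v i)%:R * Ab.1 i + Ab.2 :> int)%R.
  move=> j; have [[b bE]|[i [b bE]]] := fE j.
    exists (fun=> 0%R, b%:R%R) => v.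
    by rewrite big1 ?bE ?add0r// => i _; rewrite mulr0.
  (* [v i (+) b] is [v i] or [1 - v i] *)
  exists (fun l => if l == i then (if b then -1 else 1)%R else 0%R,
          b%:R%R) => v.
  rewrite (bigD1 i)//= eqxx big1 ?addr0; last first.
    by move=> l /negPf ->; rewrite mulr0.
  by rewrite bE; case: (v i) b {bE} => -[].
exists (\matrix_(i, j) (A j).1 i)%R, (\row_j (A j).2)%R => v.
apply/rowP => j; rewrite !mxE AE; congr (_ + _)%R.
by apply: eq_bigr => i _; rewrite !mxE.
Qed.

Lemma cube_morphism_id n : cube_morphism (@id (vertex n)).
Proof.
by apply: cube_morphism_coord => j; right; exists j, false => v; rewrite addbF.
Qed.

Definition upd n (i : 'I_n) (b : bool) (v : vertex n) : vertex n :=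
  [ffun j => if j == i then b else v j].

Definition meetv n (v w : vertex n) : vertex n := [ffun j => v j && w j].

Lemma cube_morphism_upd n (i : 'I_n) b : cube_morphism (upd i b).
Proof.
apply: cube_morphism_coord => j; case: (eqVneq j i) => [->|/negPf ji].
  by left; exists b => v; rewrite ffunE eqxx.
by right; exists j, false => v; rewrite ffunE ji addbF.
Qed.

Lemma cube_morphism_meetv n (v : vertex n) : cube_morphism (meetv v).
Proof.
apply: cube_morphism_coord => j; case vj: (v j).
  by right; exists j, false => w; rewrite ffunE vj addbF.
by left; exists false => w; rewrite ffunE vj.
Qed.

Lemma cube_morphism_eps n (i : 'I_n) : cube_morphism (@eps n i).
Proof.
apply: cube_morphism_coord => j; case ij: (unlift i j) => [k|].
  by right; exists k, false => w; rewrite ffunE ij addbF.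
by left; exists false => w; rewrite ffunE ij.
Qed.

(** A left inverse of the facet inclusion [eps i]. *)
Definition face_proj n (i : 'I_n) (v : vertex n) : vertex n.-1 :=
  [ffun k => v (lift i k)].

Lemma cube_morphism_face_proj n (i : 'I_n) : cube_morphism (face_proj i).
Proof.
apply: cube_morphism_coord => j.
by right; exists (lift i j), false => w; rewrite ffunE addbF.
Qed.

Lemma eps_face_proj n (i : 'I_n) v : eps i (face_proj i v) = upd i false v.
Proof.
apply/ffunP => j; rewrite !ffunE; case: unliftP => [k ->|->].
  by rewrite ffunE eq_sym (negPf (neq_lift _ _)).
by rewrite eqxx.
Qed.

Lemma upd_eps n (i : 'I_n) w : upd i false (eps i w) = eps i w.
Proof.
apply/ffunP => j; rewrite !ffunE; case: unliftP => [k ->|->].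
  by rewrite eq_sym (negPf (neq_lift _ _)).
by rewrite eqxx.
Qed.

Lemma upd_id n (i : 'I_n) b (v : vertex n) : v i = b -> upd i b v = v.
Proof. by move=> <-; apply/ffunP => j; rewrite ffunE; case: eqP => // ->. Qed.

Lemma neq_topP n (v : vertex n) :
  reflect (exists i, ~~ v i) (v != top_vertex n).
Proof.
apply: (iffP idP) => [vt|[i]]; last first.
  by apply: contra => /eqP ->; rewrite ffunE.
apply/existsP; move: vt; apply: contraR; rewrite negb_exists => /forallP vt.
by apply/eqP/ffunP => j; rewrite ffunE; apply/negPn.
Qed.

Lemma upd_neq_top n (i : 'I_n) v : upd i false v != top_vertex n.
Proof. by apply/neq_topP; exists i; rewrite ffunE eqxx. Qed.

Lemma corner_neq_top n (v : corner n) : val v != top_vertex n.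
Proof.
have /existsP[i /existsP[w /eqP ->]] := valP v.
by rewrite -upd_eps upd_neq_top.
Qed.

Lemma corner_of_subproof n (v : vertex n) : v != top_vertex n ->
  [exists i : 'I_n, exists w : vertex n.-1, v == eps i w].
Proof.
move=> /neq_topP[i vi]; apply/existsP; exists i; apply/existsP.
by exists (face_proj i v); rewrite eps_face_proj upd_id//; exact/negbTE.
Qed.

Definition corner_of n (v : vertex n) (vt : v != top_vertex n) : corner n :=
  exist _ v (corner_of_subproof vt).

(** * Cubes, corners and fibrations on functions of vertices *)

Lemma cube_face T (C : cubeset T) m n (f : vertex m -> vertex n) c c' :
  cube_morphism f -> cube C n c -> (forall v, c' v = c (f v)) -> cube C m c'.
Proof.
by move=> fm cc c'E; rewrite (_ : c' = c \o f); [exact: cube_comp|exact/funext].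
Qed.

(** The Yoneda lemma for representable cubesets. *)
Lemma Hom_BoxE n T (C : cubeset T) (c : vertex n -> T) :
  Hom (Box n) C c <-> cube C n c.
Proof.
split => [hc|cc m g gm]; last exact: cube_comp.
exact: (hc n id (cube_morphism_id n)).
Qed.

(** A map on the corner, encoded by any extension of it to the whole cube (see
    [Hom_CornerE]): collapsing coordinate [i] to 0 reads off the facet [eps i]
    without changing the dimension. *)
Definition pre_cube n T (C : cubeset T) (c : vertex n -> T) :=
  forall i, cube C n (c \o upd i false).

Lemma Hom_CornerE n T (C : cubeset T) (c : vertex n -> T) :
  Hom (Corner n) C (c \o val) <-> pre_cube C c.
Proof.
split=> [hc i|cc m u [i [g [gm uE]]]]; last first.
  apply: (cube_face (cube_morphism_comp (cube_morphism_eps i) gm) (cc i)).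
  by move=> v /=; rewrite upd_eps uE.
pose u v : corner n := corner_of (upd_neq_top i v).
have cu : cube (Corner n) n u.
  by exists i, (face_proj i); split=> [|w]; [exact: cube_morphism_face_proj|
    rewrite eps_face_proj].
exact: hc n u cu.
Qed.

Lemma corner_extend n T (x : T) (u : corner n -> T) :
  exists c : vertex n -> T, u = c \o val.
Proof.
exists (fun v => if insub v is Some w then u w else x).
by apply/funext => v /=; rewrite valK.
Qed.

Lemma eq_on_corner n T (c c' : vertex n -> T) :
  c \o (val : corner n -> _) = c' \o val <->
  (forall v, v != top_vertex n -> c v = c' v).
Proof.
split=> [cc' v vt|cc']; first exact: (congr1 (@^~ (corner_of vt)) cc').
by apply/funext => v /=; apply: cc'; exact: corner_neq_top.
Qed.

Definition vzero n : vertex n := [ffun=> false].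

Lemma vzero_neq_top n : 0 < n -> vzero n != top_vertex n.
Proof. by case: n => // n _; apply/neq_topP; exists ord0; rewrite ffunE. Qed.

Lemma fibrationE S T (C : cubeset S) (D : cubeset T) (f : S -> T) :
  fibration C D f <-> Hom C D f /\
   forall n, 0 < n -> forall c d, pre_cube C c -> cube D n d ->
    (forall v, v != top_vertex n -> f (c v) = d v) ->
    exists h, [/\ cube C n h, forall v, v != top_vertex n -> h v = c v &
                  forall v, f (h v) = d v].
Proof.
split=> -[fh fl]; split=> // n n0.
  move=> c d /Hom_CornerE cc /Hom_BoxE cd fcd.
  have [|h [/Hom_BoxE ch /eq_on_corner hc hd]] := fl n n0 (c \o val) d cc cd.
    exact/(@eq_on_corner _ _ (f \o c) d).
  by exists h; split=> // v; rewrite -hd.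
move=> u d; have [c ->] := corner_extend (u (corner_of (vzero_neq_top n0))) u.
move=> /Hom_CornerE cc /Hom_BoxE cd /(@eq_on_corner _ _ (f \o c) d) fcd.
have [h [ch hc hd]] := fl n n0 c d cc cd fcd.
exists h; split; [exact/Hom_BoxE|exact/eq_on_corner|exact/funext].
Qed.

Lemma nstepE N T (C : cubeset T) : nstep N C <-> forall k, N < k ->
  (forall c c', cube C k c -> cube C k c' ->
    (forall v, v != top_vertex k -> c v = c' v) -> c = c') /\
  (forall c, pre_cube C c -> exists2 h, cube C k h &
     forall v, v != top_vertex k -> h v = c v).
Proof.
split=> [hC k Nk|hC k Nk].
  have [_ inj sur] := hC k Nk.
  split=> [c c' /Hom_BoxE cc /Hom_BoxE cc' e|c /Hom_CornerE cc].
    by apply: inj; rewrite ?inE//; exact/eq_on_corner.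
  have [h /Hom_BoxE ch /eq_on_corner hc] := sur _ cc.
  by exists h.
have [inj sur] := hC k Nk; split.
- by move=> c /Hom_BoxE cc; apply/Hom_CornerE => i; apply: cube_comp => //;
    exact: cube_morphism_upd.
- move=> c c'; rewrite !inE => /Hom_BoxE cc /Hom_BoxE cc' /eq_on_corner.
  exact: inj.
- move=> u; have k0 := leq_ltn_trans (leq0n _) Nk.
  have [c ->] := corner_extend (u (corner_of (vzero_neq_top k0))) u.
  move=> /Hom_CornerE /sur[h ch hc]; exists h; first exact/Hom_BoxE.
  exact/eq_on_corner.
Qed.

(** * Extension from lower sets *)

(** Closure under [meetv v] is closure under passing to smaller vertices, and
    [c \o meetv v] is a cube exactly when [c] is a cube on the lower face of all
    vertices below [v]; this expresses partially defined cubes without leaving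
    the dimension [n]. *)
Definition lower_set n (A : {set vertex n}) :=
  forall v w, v \in A -> meetv v w \in A.

Definition coords_of n (v : vertex n) := [set i | v i].

(** The lower face below [v] is a cube of dimension the number of ones of [v];
    [below_embed] and [below_proj] are its inclusion and its retraction. *)
Definition below_embed n (v : vertex n) (w : vertex #|coords_of v|) :
  vertex n :=
  [ffun j => [exists i, w i && (enum_val i == j)]].

Definition below_proj n (v w : vertex n) : vertex #|coords_of v| :=
  [ffun i => w (enum_val i)].

Section Below.
Variables (n : nat) (v : vertex n).

Lemma below_embed_enum (w : vertex #|coords_of v|) i :
  below_embed w (enum_val i) = w i.
Proof.
rewrite ffunE; apply/existsP/idP => [[i' /andP[wi /eqP/enum_val_inj <-]]//|wi].
by exists i; rewrite wi eqxx.
Qed.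

Lemma below_embed_out (w : vertex #|coords_of v|) j :
  ~~ v j -> below_embed w j = false.
Proof.
move=> vj; rewrite ffunE; apply/negbTE/existsPn => i.
apply: contra vj => /andP[_ /eqP <-].
by have := enum_valP i; rewrite inE.
Qed.

Lemma cube_morphism_below_embed : cube_morphism (@below_embed n v).
Proof.
apply: cube_morphism_coord => j; have [vj|vj] := boolP (v j); last first.
  by left; exists false => w; exact: below_embed_out.
have jv : j \in coords_of v by rewrite inE.
right; exists (enum_rank_in jv j), false => w.
by rewrite addbF -{1}(enum_rankK_in jv jv) below_embed_enum.
Qed.

Lemma cube_morphism_below_proj : cube_morphism (below_proj v).
Proof.
apply: cube_morphism_coord => j.
by right; exists (enum_val j), false => w; rewrite ffunE addbF.
Qed.

Lemma below_projK w : below_embed (below_proj v w) = meetv v w.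
Proof.
apply/ffunP => j; have [vj|vj] := boolP (v j); last first.
  by rewrite below_embed_out// ffunE (negbTE vj).
have jv : j \in coords_of v by rewrite inE.
rewrite -(enum_rankK_in jv jv) below_embed_enum !ffunE.
by rewrite (enum_rankK_in jv jv) vj.
Qed.

Lemma below_embed_top : below_embed (top_vertex #|coords_of v|) = v.
Proof.
rewrite (_ : top_vertex _ = below_proj v v).
  by rewrite below_projK; apply/ffunP => j; rewrite ffunE andbb.
by apply/ffunP => i; rewrite !ffunE; have := enum_valP i; rewrite inE.
Qed.

Lemma below_embedK : cancel (@below_embed n v) (below_proj v).
Proof. by move=> w; apply/ffunP => i; rewrite ffunE below_embed_enum. Qed.

Lemma meetv_below_embed (u w : vertex #|coords_of v|) :
  meetv (below_embed u) (below_embed w) = below_embed (meetv u w).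
Proof.
apply/ffunP => j; have [vj|vj] := boolP (v j); last first.
  by rewrite ffunE !below_embed_out.
have jv : j \in coords_of v by rewrite inE.
rewrite -(enum_rankK_in jv jv) ffunE 3!below_embed_enum [RHS]ffunE //.
Qed.

Lemma below_embed_le (w : vertex #|coords_of v|) :
  meetv v (below_embed w) = below_embed w.
Proof.
apply/ffunP => j; rewrite ffunE.
by case: (boolP (v j)) => // /below_embed_out ->.
Qed.

End Below.

Lemma meetvv n (v : vertex n) : meetv v v = v.
Proof. by apply/ffunP => j; rewrite !ffunE andbb. Qed.

Lemma meetv_top n (v : vertex n) : meetv (top_vertex n) v = v.
Proof. by apply/ffunP => j; rewrite !ffunE. Qed.

Lemma upd_meetv n (i : 'I_n) v :
  upd i false v = meetv (upd i false (top_vertex n)) v.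
Proof. by apply/ffunP => j; rewrite !ffunE; case: eqP. Qed.

Definition set_at n T (c : vertex n -> T) v x w := if w == v then x else c w.

Lemma cube_cst n T (C : cubeset T) (x : T) : cube C n (fun=> x).
Proof.
apply: (@cube_face _ C n 0 (fun=> vzero 0) (fun=> x)) => //.
  exact: cube_morphism_cst.
exact: cube_point.
Qed.

(** The vertices strictly below [v] form the corner of the face below [v], so
    the lifting property of the fibration supplies a value at [v].  For [v = 0]
    that face is a point, whose corner is empty; surjectivity takes over. *)
Lemma fibration_extend1 S T (C : cubeset S) (D : cubeset T) f n (v : vertex n)
    c d :
  fibration C D f -> (forall y, exists x, f x = y) ->
  (forall w, meetv v w != v -> cube C n (c \o meetv (meetv v w))) ->
  cube D n (d \o meetv v) ->
  (forall w, meetv v w != v -> f (c (meetv v w)) = d (meetv v w)) ->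
  exists x, f x = d v /\ cube C n (set_at c v x \o meetv v).
Proof.
move=> /fibrationE[_ fl] fsurj cc cd fcd.
have embed_lt w : w != top_vertex #|coords_of v| ->
    meetv v (below_embed w) != v /\ meetv v (below_embed w) = below_embed w.
  move=> wt; rewrite below_embed_le; split => //; apply: contra wt => /eqP wv.
  by apply/eqP/(can_inj (@below_embedK n v)); rewrite wv below_embed_top.
have [v0|v0] := posnP #|coords_of v|.
  have [x xE] := fsurj (d v); exists x; split => //.
  apply: (@cube_face _ C n n id (fun=> x)).
  - exact: cube_morphism_id.
  - exact: cube_cst.
  move=> w; rewrite /= /set_at (_ : meetv v w == v) //.
  apply/eqP/ffunP => j; rewrite ffunE.
  by have /setP/(_ j) := cards0_eq v0; rewrite !inE => ->.
have [i|||h [ch hc hd]] :=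
  fl _ v0 (c \o @below_embed n v) (d \o @below_embed n v).
- have [lt e] := embed_lt _ (upd_neq_top i (top_vertex _)).
  apply: (cube_face (cube_morphism_below_embed v) (cc _ lt)) => w /=.
  by rewrite e meetv_below_embed -upd_meetv.
- apply: (cube_face (cube_morphism_below_embed v) cd) => w /=.
  by rewrite below_embed_le.
- by move=> w /embed_lt[lt e] /=; rewrite -e fcd.
exists (h (top_vertex _)); split; first by rewrite hd /= below_embed_top.
apply: (cube_face (cube_morphism_below_proj v) ch) => w /=.
rewrite /set_at; case: eqVneq => [wv|wv].
  congr h; apply: (can_inj (@below_embedK n v)).
  by rewrite below_embed_top below_projK.
rewrite hc /= ?below_projK //; apply: contra wv => /eqP wt.
by rewrite -below_projK wt below_embed_top.
Qed.

(** Vertices are added one at a time, always one that is minimal among those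
    missing, so that all vertices below it are already lifted. *)
Lemma fibration_extend S T (C : cubeset S) (D : cubeset T) f n
    (A B : {set vertex n}) c d :
  fibration C D f -> (forall y, exists x, f x = y) ->
  lower_set A -> lower_set B -> A \subset B ->
  (forall v, v \in A -> cube C n (c \o meetv v)) ->
  (forall v, v \in B -> cube D n (d \o meetv v)) ->
  (forall v, v \in A -> f (c v) = d v) ->
  exists h, [/\ forall v, v \in A -> h v = c v,
    forall v, v \in B -> cube C n (h \o meetv v) &
    forall v, v \in B -> f (h v) = d v].
Proof.
move=> fib fsurj lA lB; have [k] := ubnP #|B :\: A|.
elim: k => // k IH in A c lA *; rewrite ltnS => Ak AB cc cd fcd.
have [BA|] := boolP (B \subset A).
  by exists c; split => // v /(fintype.subsetP BA); [exact: cc|exact: fcd].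
move=> /fintype.subsetPn[v0 v0B v0A].
have v0P : v0 \in B :\: A by rewrite inE v0A.
have [v vP vmin] := @arg_minnP _ v0 (fun v => v \in B :\: A)
  (fun v => #|coords_of v|) v0P.
have /andP[vA vB] : (v \notin A) && (v \in B) by rewrite inE in vP.
have below w : meetv v w != v -> meetv v w \in A.
  move=> wv; apply: contraT => wA.
  have /vmin : meetv v w \in B :\: A by rewrite inE wA lB.
  have sub : coords_of (meetv v w) \subset coords_of v.
    by apply/fintype.subsetP => j; rewrite !inE ffunE => /andP[].
  move=> le; have : coords_of (meetv v w) == coords_of v by rewrite eqEcard sub.
  move=> /eqP/setP e; case/eqP: wv; apply/ffunP => j.
  by have := e j; rewrite !inE.
have [|||x [fx cx]] := @fibration_extend1 _ _ _ _ _ _ v c d fib fsurj.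
- by move=> w /below/cc.
- exact: cd.
- by move=> w /below/fcd.
have stab w u : w \in A -> set_at c v x (meetv w u) = c (meetv w u).
  by move=> wA; rewrite /set_at; case: eqP => // e; rewrite -e lA in vA.
have [||||||h [hA hB fh]] := IH (v |: A) (set_at c v x).
- move=> u w; rewrite !inE => /orP[/eqP->|uA]; last by rewrite lA ?orbT.
  by case: eqVneq => //= /below ->.
- rewrite (leq_trans _ Ak)//; apply: proper_card; apply/properP; split.
    by apply/fintype.subsetP => u; rewrite !inE negb_or -andbA => /andP[_].
  by exists v; rewrite !inE ?vA ?eqxx.
- by rewrite finset.subUset finset.sub1set vB.
- move=> u; rewrite !inE => /orP[/eqP->//|uA].
  by apply: (cube_face (@cube_morphism_id n) (cc u uA)) => w /=; rewrite stab.
- exact: cd.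
- move=> u; rewrite !inE /set_at; case: eqVneq => //= [->//|_]; exact: fcd.
exists h; split => // u uA.
by rewrite hA ?inE ?uA ?orbT// -(meetvv u) stab.
Qed.

(** The case where the base is a point and all vertices are to be filled. *)
Lemma fibrant_extend T (C : cubeset T) n (A : {set vertex n}) c :
  fibrant C -> lower_set A ->
  (forall v, v \in A -> cube C n (c \o meetv v)) ->
  exists2 h, cube C n h & forall v, v \in A -> h v = c v.
Proof.
move=> fib lA cc.
have [||||||h [hA hT _]] :=
  @fibration_extend _ _ _ _ _ _ A [set: vertex n] c (fun=> tt) fib _ lA.
- by case; exists (c (vzero n)).
- by move=> v w; rewrite !inE.
- exact: finset.subsetT.
- exact: cc.
- by [].
- by [].
exists h => //; have := hT (top_vertex n); rewrite inE => /(_ isT) ch.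
by apply: (cube_face (@cube_morphism_id n) ch) => v /=; rewrite meetv_top.
Qed.

(** * Gluing *)

(** Put [c] and [c'] on two facets of an (n+1)-cube meeting along their common
    facet; these fill an L-shape [A], and the diagonal of the filled cube joins
    the outer facet of [c] to the outer facet of [c']. *)
Lemma cube_glue T (C : cubeset T) n (j : 'I_n) c c' : fibrant C ->
  cube C n c -> cube C n c' ->
  (forall v, c (upd j true v) = c' (upd j false v)) ->
  cube C n (fun v => if v j then c' v else c v).
Proof.
move=> fib cc cc' ccE.
(* coordinate 0 of the (n+1)-cube moves along [c'], coordinate j along [c] *)
pose res (u : vertex n.+1) : vertex n := [ffun i => u (lift ord0 i)].
pose flip (v : vertex n) : vertex n := [ffun i => v i (+) (i == j)].
pose A := [set u : vertex n.+1 | ~~ (u ord0 && u (lift ord0 j))].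
pose F (u : vertex n.+1) :=
  if u ord0 then c' (upd j true (res u)) else c (flip (res u)).
have lA : lower_set A.
  move=> u w; rewrite !inE !ffunE; apply: contra.
  by move=> /andP[/andP[-> _] /andP[-> _]].
have [u|h ch hA] := @fibrant_extend _ C _ A F fib lA.
  rewrite inE; case u0 : (u ord0).
    move=> /= /negPf uj.
    have fm : cube_morphism (fun w => upd j (w ord0) (res (meetv u w))).
      apply: cube_morphism_coord => i; case: (eqVneq i j) => [->|/negPf ij].
        by right; exists ord0, false => w; rewrite !ffunE eqxx addbF.
      case ui: (u (lift ord0 i)).
        by right; exists (lift ord0 i), false => w; rewrite !ffunE ui ij addbF.
      by left; exists false => w; rewrite !ffunE ui ij.
    apply: (cube_face fm cc') => w; rewrite /= /F ffunE u0 /=.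
    case: ifP => // _; rewrite -ccE; congr c; apply/ffunP => i.
    rewrite !ffunE; case: eqP => [->|]; first by rewrite uj.
    by rewrite addbF.
  move=> _; have fm : cube_morphism (fun w => flip (res (meetv u w))).
    apply: cube_morphism_coord => i; case ui: (u (lift ord0 i)).
      by right; exists (lift ord0 i), (i == j) => w; rewrite !ffunE ui.
    by left; exists (i == j) => w; rewrite !ffunE ui.
  by apply: (cube_face fm cc) => w; rewrite /= /F ffunE u0.
(* the diagonal from the end of [c] to the end of [c'] *)
pose diag (v : vertex n) : vertex n.+1 :=
  [ffun i => if unlift ord0 i is Some k then (if k == j then ~~ v j else v k)
             else v j].
have diag0 v : diag v ord0 = v j by rewrite ffunE unlift_none.
have diagS v i : diag v (lift ord0 i) = if i == j then ~~ v j else v i.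
  by rewrite ffunE liftK.
have dm : cube_morphism diag.
  apply: cube_morphism_coord => i; case: (unliftP ord0 i) => [k ->|->].
    case: (eqVneq k j) => [->|/negPf kj].
      by right; exists j, true => v; rewrite diagS eqxx addbT.
    by right; exists k, false => v; rewrite diagS kj addbF.
  by right; exists j, false => v; rewrite diag0 addbF.
apply: (cube_face dm ch) => v; rewrite hA; last first.
  by rewrite inE diag0 diagS eqxx andbN.
rewrite /F diag0; case vj: (v j).
  by congr c'; apply/ffunP => i; rewrite !ffunE liftK; case: eqP => // ->.
congr c; apply/ffunP => i; rewrite !ffunE liftK.
by case: eqP => [->|]; rewrite ?addbF // vj.
Qed.

Definition on_top n (J : seq 'I_n) (v : vertex n) := all v J.

(** Suppose [a] and [a'] agree except on the face where the coordinates in [J]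
    are 1.  Gluing the reflection of [a] along [j] to [a'] cancels what they
    have in common, leaving a pair that differs on a face defined by one
    coordinate fewer; gluing [c] back restores that coordinate.  For [J] empty
    the result is [a'] itself. *)
Lemma cube_replace T (C : cubeset T) n (J : seq 'I_n) a a' c : fibrant C ->
  cube C n a -> cube C n a' -> cube C n c ->
  (forall v, ~~ on_top J v -> a v = a' v) ->
  (forall v, on_top J v -> c v = a v) ->
  cube C n (fun v => if on_top J v then a' v else c v).
Proof.
move=> fib; elim: J => [|j J IH] /= in a a' c *.
  by move=> _ ca' _ _ _.
move=> ca ca' cc aa' cca.
have um b : cube_morphism (@upd n j b) by exact: cube_morphism_upd.
have top_upd v : on_top J v -> on_top J (upd j true v).
  by move=> /allP Jv; apply/allP => i /Jv vi; rewrite ffunE; case: eqP.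
have flipm : cube_morphism (fun v => upd j (~~ v j) v).
  apply: cube_morphism_coord => i; case: (eqVneq i j) => [->|/negPf ij].
    by right; exists j, true => v; rewrite ffunE eqxx addbT.
  by right; exists i, false => v; rewrite ffunE ij addbF.
have updupd b b' v : upd j b (upd j b' v) = upd j b v.
  by apply/ffunP => i; rewrite !ffunE; case: eqP.
have updj b v : upd j b v j = b by rewrite ffunE eqxx.
have c1 : cube C n (c \o upd j true) by exact: cube_comp.
have a1 : cube C n (a \o upd j true) by exact: cube_comp.
(* the glued cube: its facet j = 0 is the facet j = 1 of [a], and its facet
   j = 1 is that of [a'] *)
have a2 : cube C n (fun v : vertex n => if v j then a' v else a (upd j true v)).
  have ca2 : cube C n (a \o (fun v : vertex n => upd j (~~ v j) v)).
    exact: cube_comp.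
  apply: (cube_face (@cube_morphism_id n)
    (cube_glue (j := j) fib ca2 ca' _)) => v.
    by rewrite /= updj updupd /= aa' // updj.
  by case: ifP => //= ->.
have cr := IH _ _ _ a1 a2 c1.
have {}cr : cube C n (fun v : vertex n => if on_top J v then
    (if v j then a' v else a (upd j true v)) else c (upd j true v)).
  apply: cr => v Jv /=; last by rewrite cca // updj top_upd.
  by case: ifP => // vj; rewrite upd_id// aa' // (negbTE Jv) andbF.
apply: (cube_face (@cube_morphism_id n) (cube_glue (j := j) fib cc cr _)) => v.
  rewrite updj updupd; case: ifP => // vJ.
  by rewrite cca // updj /= -(updupd true false) top_upd.
by case vj : (v j) => //=; rewrite upd_id.
Qed.

(** * Truncations *)

Lemma fibrantE T (C : cubeset T) : fibrant C <->
  forall n, 0 < n -> forall c : vertex n -> T, pre_cube C c ->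
    exists2 h, cube C n h & forall v, v != top_vertex n -> h v = c v.
Proof.
rewrite /fibrant fibrationE; split=> [[_ fC] n n0 c cc|fC].
  by have [//|//|h [ch hc _]] := fC n n0 c (fun=> tt) cc; exists h.
split=> // n n0 c d cc _ _; have [h ch hc] := fC n n0 c cc.
by exists h; split => // v; case: (d v).
Qed.

Definition delta n T (x y : T) (v : vertex n) :=
  if v == top_vertex n then y else x.

Lemma on_top_enum n (v : vertex n) : on_top (enum 'I_n) v = (v == top_vertex n).
Proof.
apply/allP/eqP => [vt|-> i _]; last by rewrite ffunE.
by apply/ffunP => i; rewrite ffunE vt ?mem_enum.
Qed.

Section FibrantRel.
Variables (T : Type) (C : cubeset T) (fib : fibrant C).

(** [cube_replace] for the set of all coordinates, where the face is the top
    vertex alone. *)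
Lemma cube_replace_top k a a' c : cube C k a -> cube C k a' -> cube C k c ->
  (forall v, v != top_vertex k -> a v = a' v) ->
  c (top_vertex k) = a (top_vertex k) ->
  cube C k (set_at c (top_vertex k) (a' (top_vertex k))).
Proof.
move=> ca ca' cc aa' cta.
have := cube_replace (J := enum 'I_k) fib ca ca' cc.
move=> cr; apply: (cube_face (@cube_morphism_id k) (cr _ _)).
- by move=> v; rewrite on_top_enum; exact: aa'.
- by move=> v; rewrite on_top_enum => /eqP ->.
- by move=> v; rewrite on_top_enum /set_at; case: eqP => // ->.
Qed.

(** The two cubes witnessing ~_n may be taken to be constant off the top. *)
Lemma trunc_relE n x y : trunc_rel n C x y <-> cube C n.+1 (delta x y).
Proof.
split=> [[c [c' [cc cc' e <- <-]]]|cd].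
  apply: (cube_face (@cube_morphism_id _)
    (@cube_replace_top _ c c' (fun=> c (top_vertex _)) _ _ _ _ _)) => //.
    exact: cube_cst.
  by move=> v vt; have := e (corner_of vt).
exists (fun=> x), (delta x y); split => //; first exact: cube_cst.
  by move=> v; rewrite /delta (negbTE (corner_neq_top v)).
by rewrite /delta eqxx.
Qed.

Lemma trunc_rel_refl n x : trunc_rel n C x x.
Proof. by exists (fun=> x), (fun=> x); split => //; exact: cube_cst. Qed.

Lemma trunc_rel_sym n x y : trunc_rel n C x y -> trunc_rel n C y x.
Proof. by move=> [c [c' [? ? e ? ?]]]; exists c', c; split. Qed.

Lemma cube_set_top n x c :
  cube C n.+1 c -> trunc_rel n C (c (top_vertex _)) x ->
  cube C n.+1 (set_at c (top_vertex _) x).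
Proof.
move=> cc [a [a' [ca ca' e ax <-]]]; apply: (cube_replace_top ca ca' cc) => //.
by move=> v vt; have := e (corner_of vt).
Qed.

Lemma trunc_rel_trans n x y z :
  trunc_rel n C x y -> trunc_rel n C y z -> trunc_rel n C x z.
Proof.
move=> /trunc_rel_sym xy [a [a' [ca ca' e ay az]]].
exists (set_at a (top_vertex _) x), a'; split => //.
- by apply: cube_set_top => //; rewrite ay.
- by move=> v; rewrite /set_at (negbTE (corner_neq_top v)).
- by rewrite /set_at eqxx.
Qed.

(** Any vertex is the top vertex after reflecting coordinates. *)
Lemma cube_set_at n u x c : cube C n.+1 c -> trunc_rel n C (c u) x ->
  cube C n.+1 (set_at c u x).
Proof.
move=> cc cux; pose r (v : vertex n.+1) : vertex n.+1 :=
  [ffun i => v i (+) ~~ u i].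
have rm : cube_morphism r.
  apply: cube_morphism_coord => i.
  by right; exists i, (~~ u i) => v; rewrite ffunE.
have rK : involutive r by move=> v; apply/ffunP => i; rewrite !ffunE addbK.
have ru : r (top_vertex _) = u.
  by apply/ffunP => i; rewrite !ffunE addTb negbK.
have cr : cube C n.+1 (c \o r) by exact: cube_comp.
apply: (cube_face rm (@cube_set_top n x _ cr _)) => [|v].
  by rewrite /= ru.
rewrite /set_at /= rK; congr (if _ then _ else _).
by rewrite (can2_eq rK rK) ru.
Qed.

Lemma cube_rel_top n c c' : cube C n.+1 c ->
  (forall v, trunc_rel n C (c v) (c' v)) -> cube C n.+1 c'.
Proof.
move=> cc e.
have H (s : seq (vertex n.+1)) :
    cube C n.+1 (fun v => if v \in s then c' v else c v).
  elim: s => [|u s IH]; first exact: (cube_face (@cube_morphism_id _) cc).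
  have eu : trunc_rel n C (if u \in s then c' u else c u) (c' u).
    by case: ifP => // _; exact: trunc_rel_refl.
  apply: (cube_face (@cube_morphism_id _) (cube_set_at IH eu)) => v.
  by rewrite /set_at inE; case: eqP => [->|].
apply: (cube_face (@cube_morphism_id _) (H (enum {: vertex n.+1}))) => v.
by rewrite mem_enum.
Qed.

(** Dimensions below [n.+1] reduce to [n.+1], since an m-cube is a face of the
    degenerate (n+1)-cube over it. *)
Lemma cube_rel n m c c' : m <= n.+1 -> cube C m c ->
  (forall v, trunc_rel n C (c v) (c' v)) -> cube C m c'.
Proof.
move=> mn cc e.
pose pr (v : vertex n.+1) : vertex m := [ffun j => v (widen_ord mn j)].
pose sec (w : vertex m) : vertex n.+1 :=
  [ffun i : 'I_n.+1 => if insub (i : nat) is Some j then w j else false].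
have prm : cube_morphism pr.
  apply: cube_morphism_coord => j; right; exists (widen_ord mn j), false => v.
  by rewrite ffunE addbF.
have secm : cube_morphism sec.
  apply: cube_morphism_coord => i.
  case ij : (insub (i : nat) : option 'I_m) => [j|].
    by right; exists j, false => w; rewrite ffunE ij addbF.
  by left; exists false => w; rewrite ffunE ij.
have secK w : pr (sec w) = w.
  by apply/ffunP => j; rewrite !ffunE /= valK.
have cp : cube C n.+1 (c \o pr) by exact: cube_comp.
have cp' : cube C n.+1 (c' \o pr) by apply: (cube_rel_top cp) => v /=.
by apply: (cube_face secm cp') => w; rewrite /= secK.
Qed.

(** Restrict to an (n+1)-dimensional face through the top vertex; there the
    values of [c'] off the top can be exchanged for those of [c]. *)
Lemma trunc_rel_top n k c c' : n < k -> cube C k c -> cube C k c' ->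
  (forall v, v != top_vertex k -> trunc_rel n C (c v) (c' v)) ->
  trunc_rel n C (c (top_vertex k)) (c' (top_vertex k)).
Proof.
move=> nk cc cc' e.
pose f (v : vertex n.+1) : vertex k :=
  [ffun j : 'I_k => if insub (j : nat) is Some i then v i else true].
have fm : cube_morphism f.
  apply: cube_morphism_coord => j.
  case ij : (insub (j : nat) : option 'I_n.+1) => [i|].
    by right; exists i, false => v; rewrite ffunE ij addbF.
  by left; exists true => v; rewrite ffunE ij.
have ft : f (top_vertex _) = top_vertex k.
  by apply/ffunP => j; rewrite !ffunE; case: insub => // i; rewrite ffunE.
have fnt v : v != top_vertex _ -> f v != top_vertex k.
  move=> /neq_topP[i vi]; apply/neq_topP; exists (widen_ord nk i).
  by rewrite ffunE /= valK.
have cf : cube C n.+1 (c \o f) by exact: cube_comp.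
have cf' : cube C n.+1 (c' \o f) by exact: cube_comp.
have cs : cube C n.+1 (set_at (c \o f) (top_vertex _) (c' (top_vertex k))).
  apply: (cube_rel_top cf') => v; rewrite /set_at; case: eqP => [->|/eqP vt] /=.
    by rewrite ft; exact: trunc_rel_refl.
  exact/trunc_rel_sym/e/fnt.
exists (c \o f), (set_at (c \o f) (top_vertex _) (c' (top_vertex k))).
split => //.
- by move=> v; rewrite /set_at (negbTE (corner_neq_top v)).
- by rewrite /= ft.
- by rewrite /set_at eqxx.
Qed.

(** The facet of [delta x y] where the first coordinate is 1 is [delta x y] in
    one dimension less. *)
Lemma trunc_rel_succ n x y : trunc_rel n.+1 C x y -> trunc_rel n C x y.
Proof.
rewrite !trunc_relE => cd.
pose f (v : vertex n.+1) : vertex n.+2 :=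
  [ffun j => if unlift ord0 j is Some i then v i else true].
have fm : cube_morphism f.
  apply: cube_morphism_coord => j; case ij : (unlift ord0 j) => [i|].
    by right; exists i, false => v; rewrite ffunE ij addbF.
  by left; exists true => v; rewrite ffunE ij.
apply: (cube_face fm cd) => v; rewrite /delta; congr (if _ then _ else _).
apply/eqP/eqP => [->|fv].
  by apply/ffunP => j; rewrite !ffunE; case: unliftP => // i _; rewrite ffunE.
by apply/ffunP => i; have := congr1 (fun w : vertex _ => w (lift ord0 i)) fv;
  rewrite !ffunE liftK.
Qed.

End FibrantRel.

Section TruncFibrant.
Variables (T : topologicalType) (C : cubeset T) (fib : fibrant C).

Definition trunc_repr n (t : trunc n C) : T :=
  repr (t : quotient_topology {eq_quot trunc_equiv n C}).

Lemma trunc_reprK n (t : trunc n C) : trunc_proj n C (trunc_repr t) = t.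
Proof. exact: reprK. Qed.

(** [trunc_rel] is already an equivalence relation on a fibrant cubeset, so the
    generated equivalence identifies nothing more. *)
Lemma trunc_projE n x y :
  trunc_proj n C x = trunc_proj n C y <-> trunc_rel n C x y.
Proof.
split=> [/eqmodP/asboolP|xy]; last first.
  by apply/eqmodP/asboolP; exact: Relation_Operators.rst_step.
elim=> {x y} [x y|x|x y _ |x y z _ xy _ yz] //.
- exact: trunc_rel_refl.
- exact: trunc_rel_sym.
- exact: trunc_rel_trans xy yz.
Qed.

Lemma trunc_proj_surj n t : exists x, trunc_proj n C x = t.
Proof. by exists (trunc_repr t); exact: trunc_reprK. Qed.

Lemma Trunc_cube_proj n m c :
  cube C m c -> cube (Trunc n C) m (trunc_proj n C \o c).
Proof. by move=> cc; exists c. Qed.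

Lemma Trunc_cubeE n m c : m <= n.+1 ->
  cube (Trunc n C) m (trunc_proj n C \o c) <-> cube C m c.
Proof.
move=> mn; split; last exact: Trunc_cube_proj.
move=> [c0 [cc0 e]]; apply: (cube_rel fib mn cc0) => v.
by apply/trunc_projE; exact: (congr1 (@^~ v) (esym e)).
Qed.

(** In dimension at most n+1 any choice of lifts of the vertices works; above
    it, any filler of the lifted corner works, its top class being forced. *)
Lemma fibration_trunc_proj n : fibration C (Trunc n C) (trunc_proj n C).
Proof.
apply/fibrationE; split=> [m c|k k0 c d cc [d0 [cd0 ->]] e].
  exact: Trunc_cube_proj.
have [kn|nk] := leqP k n.+1.
  exists (set_at c (top_vertex k) (d0 (top_vertex k))).
  have E v : trunc_proj n C (set_at c (top_vertex k) (d0 (top_vertex k)) v) =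
     (trunc_proj n C \o d0) v.
    by rewrite /set_at; case: eqP => [->|/eqP /e].
  split=> //.
    apply/(Trunc_cubeE _ kn); exists d0; split => //; exact/funext.
  by move=> v vt; rewrite /set_at (negbTE vt).
have /fibrantE := fib => /(_ k k0 c cc)[h ch hc]; exists h; split => // v.
have H w : w != top_vertex k -> trunc_rel n C (h w) (d0 w).
  by move=> wt; apply/trunc_projE; rewrite hc ?e.
apply/trunc_projE; have [->|/H//] := eqVneq v (top_vertex k).
exact: trunc_rel_top (ltnW nk) ch cd0 H.
Qed.

(** Lift the corner to [C] along [fibration_trunc_proj], fill it there, and
    project. *)
Lemma fibrant_Trunc n : fibrant (Trunc n C).
Proof.
apply/fibrantE => k k0 c cc.
pose B := [set v : vertex k | v != top_vertex k].
have lB : lower_set B.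
  move=> v w; rewrite !inE => /neq_topP[i vi]; apply/neq_topP; exists i.
  by rewrite ffunE (negbTE vi).
have [|||||h [_ hB fh]] := @fibration_extend _ _ _ _ _ _ (finset.set0) B
  (fun v => trunc_repr (c v)) c (fibration_trunc_proj n) (@trunc_proj_surj n)
  _ lB.
- by move=> v w; rewrite inE.
- exact: finset.sub0set.
- by move=> v; rewrite inE.
- move=> v; rewrite inE => /neq_topP[i vi].
  apply: (cube_face (cube_morphism_meetv v) (cc i)) => w /=.
  by rewrite upd_id// ffunE (negbTE vi).
- by move=> v; rewrite inE.
have [h' ch' hh'] := fibrant_extend fib lB hB.
exists (trunc_proj n C \o h'); first exact: Trunc_cube_proj.
by move=> v vt /=; rewrite hh' ?inE// fh ?inE.
Qed.

Lemma nstep_Trunc n : nstep n (Trunc n C).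
Proof.
apply/nstepE => k nk; split; last first.
  by have /fibrantE := fibrant_Trunc n; apply; exact: leq_ltn_trans nk.
move=> _ _ [c [cc ->]] [c' [cc' ->]] e.
have H w : w != top_vertex k -> trunc_rel n C (c w) (c' w).
  by move=> wt; apply/trunc_projE/e.
apply/funext => v /=; apply/trunc_projE.
have [->|/H//] := eqVneq v (top_vertex k).
exact: trunc_rel_top H.
Qed.

Definition trunc_down n (t : trunc n.+1 C) : trunc n C :=
  trunc_proj n C (trunc_repr t).

Lemma trunc_down_proj n x : trunc_down (trunc_proj n.+1 C x) = trunc_proj n C x.
Proof.
apply/trunc_projE/trunc_rel_succ => //; apply/trunc_projE.
exact: trunc_reprK.
Qed.

(** Fill the corner upstairs and lift the filler to a cube of [C]; its corner
    can then be completed over the given cube along [fibration_trunc_proj]. *)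
Lemma fibration_trunc_down n :
  fibration (Trunc n.+1 C) (Trunc n C) (@trunc_down n).
Proof.
apply/fibrationE; split=> [m _ [c [cc ->]]|k k0 c d cc cd e].
  by exists c; split => //; apply/funext => v /=; exact: trunc_down_proj.
have /fibrantE/(_ k k0 c cc)[_ [h [ch ->]] hc] := fibrant_Trunc n.+1.
have /fibrationE[_ /(_ k k0 h d)] := fibration_trunc_proj n.
case=> [i|//|v vt|h' [ch' hh' fh']].
- by apply: cube_comp => //; exact: cube_morphism_upd.
- by rewrite -e// -hc //= trunc_down_proj.
exists (trunc_proj n.+1 C \o h'); split => [|v vt|v].
- exact: Trunc_cube_proj.
- by rewrite /= hh' // -hc.
- by rewrite /= trunc_down_proj fh'.
Qed.

(** By [Trunc_cubeE] the cubes of dimension n+1 that define ~_n are the same in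
    [C] and in its truncation. *)
Lemma trunc_down_eq n s t : trunc_down s = trunc_down t <->
  trunc_rel n (Trunc n.+1 C) s t.
Proof.
rewrite -[s]trunc_reprK -[t]trunc_reprK !trunc_down_proj trunc_projE.
rewrite !trunc_relE //; last exact: fibrant_Trunc.
rewrite (_ : delta _ _ =
  trunc_proj n.+1 C \o delta (trunc_repr s) (trunc_repr t)).
  by rewrite Trunc_cubeE.
by apply/funext => v; rewrite /= /delta; case: ifP.
Qed.

End TruncFibrant.

(** * Parallel transport in the top fibre *)

(** The configuration equal to [delta x y] on the facet where the first
    coordinate is 0, and to [delta x' y'] on the opposite facet. *)
Definition quad n T (x y x' y' : T) (v : vertex n.+1) : T :=
  (if v ord0 then delta x' y' else delta x y) (face_proj ord0 v).

Section Quad.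
Variables (T : Type) (D : cubeset T) (n : nat).
Hypotheses (fib : fibrant D) (stepn : nstep n D).
Hypothesis (conn : forall x y, trunc_rel 0 D x y).

Notation tail := (@face_proj n.+1 ord0).
Notation transport x y x' y' := (cube D n.+1 (quad x y x' y')).

Lemma cube_edge m (i : 'I_m) x y : cube D m (fun v => if v i then y else x).
Proof.
have /(trunc_relE fib) cd := conn x y.
have fm : cube_morphism (fun v : vertex m => [ffun _ : 'I_1 => v i] : vertex 1).
  apply: cube_morphism_coord => j; right; exists i, false => v.
  by rewrite ffunE addbF.
apply: (cube_face fm cd) => v; rewrite /delta.
rewrite (_ : (_ == _) = v i)//; apply/eqP/idP => [/ffunP/(_ ord0)|vi].
  by rewrite !ffunE.
by apply/ffunP => j; rewrite !ffunE.
Qed.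

Lemma transport_hrefl x y : cube D n (delta x y) -> transport x y x y.
Proof.
move=> cd; apply: (cube_face (@cube_morphism_face_proj n.+1 ord0) cd) => v.
by rewrite /quad if_same.
Qed.

Lemma transport_hsym x y x' y' : transport x y x' y' -> transport x' y' x y.
Proof.
have fm : cube_morphism (fun v : vertex n.+1 => upd ord0 (~~ v ord0) v).
  apply: cube_morphism_coord => i; case: (eqVneq i ord0) => [->|/negPf i0].
    by right; exists ord0, true => v; rewrite ffunE eqxx addbT.
  by right; exists i, false => v; rewrite ffunE i0 addbF.
move=> cq; apply: (cube_face fm cq) => v; rewrite /quad ffunE eqxx.
rewrite (_ : tail (upd _ _ _) = tail v); first by case: (v ord0).
by apply/ffunP => i; rewrite !ffunE.
Qed.

Lemma transport_htrans x y x' y' x'' y'' :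
  transport x y x' y' -> transport x' y' x'' y'' -> transport x y x'' y''.
Proof.
move=> cq cq'.
apply: (cube_face (@cube_morphism_id _)
  (cube_glue (j := ord0) fib cq cq' _)) => v.
  rewrite /quad !ffunE eqxx; congr (delta _ _ _).
  by apply/ffunP => i; rewrite !ffunE.
by rewrite /quad; case: (v ord0).
Qed.

Lemma transport_vrefl x x' : transport x x x' x'.
Proof.
apply: (cube_face (@cube_morphism_id _) (cube_edge ord0 x x')) => v.
by rewrite /quad /delta; case: (v ord0); rewrite if_same.
Qed.

Lemma on_top_tail (v : vertex n.+1) :
  on_top [seq lift ord0 i | i <- enum 'I_n] v = (tail v == top_vertex n).
Proof.
rewrite -on_top_enum /on_top all_map; apply: eq_all => i /=.
by rewrite ffunE.
Qed.

(** Replace [y] by [z] and [y'] by [z'] at once, on the edge where all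
    coordinates but the first are 1. *)
Lemma transport_vtrans x y z x' y' z' :
  transport x y x' y' -> transport y z y' z' -> transport x z x' z'.
Proof.
move=> cq cq'.
have cr := cube_replace fib (transport_vrefl y y') cq' cq (J := _).
apply: (cube_face (@cube_morphism_id _)
  (cr [seq lift ord0 i | i <- enum 'I_n] _ _)) => v; rewrite on_top_tail;
  rewrite /quad /delta.
- by move=> /negPf vt; case: (v ord0); rewrite /= vt.
- by move=> vt; case: (v ord0); rewrite /= vt.
- by case: (v ord0); case: ifP.
Qed.

(** On the same edge, replace [y] and [y'] by [x] and [x'] in the 1-cube from
    [y] to [y']. *)
Lemma transport_vsym x y x' y' : transport x y x' y' -> transport y x y' x'.
Proof.
move=> cq.
have cr := cube_replace fib cq (transport_vrefl x x') (transport_vrefl y y')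
  (J := _).
apply: (cube_face (@cube_morphism_id _)
  (cr [seq lift ord0 i | i <- enum 'I_n] _ _)) => v; rewrite on_top_tail;
  rewrite /quad /delta.
- by move=> /negPf vt; case: (v ord0); rewrite /= vt.
- by move=> vt; case: (v ord0); rewrite /= vt.
- by case: (v ord0); case: ifP.
Qed.

Lemma tail_eps w : tail (eps ord0 w) = w.
Proof. by apply/ffunP => i; rewrite !ffunE liftK. Qed.

Lemma transport_source x y x' y' : transport x y x' y' -> cube D n (delta x y).
Proof.
move=> cq; apply: (cube_face (@cube_morphism_eps n.+1 ord0) cq) => w.
by rewrite /quad ffunE unlift_none tail_eps.
Qed.

Lemma transport_target x y x' y' :
  transport x y x' y' -> cube D n (delta x' y').
Proof. by move=> /transport_hsym/transport_source. Qed.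

Lemma quad_top (x y x' y' : T) : quad x y x' y' (top_vertex n.+1) = y'.
Proof.
rewrite /quad ffunE /delta (_ : tail _ = top_vertex n) ?eqxx //.
by apply/ffunP => i; rewrite !ffunE.
Qed.

Lemma top_of_tail (v : vertex n.+1) :
  v ord0 -> tail v = top_vertex n :> vertex n -> v = top_vertex n.+1.
Proof.
move=> v0 /ffunP vt; apply/ffunP => j; rewrite ffunE.
case: (unliftP ord0 j) => [i|] -> //.
by have := vt i; rewrite !ffunE.
Qed.

Lemma quad_neq_top (x y x' y' z : T) (v : vertex n.+1) : v != top_vertex n.+1 ->
  quad x y x' y' v = quad x y x' z v.
Proof.
rewrite /quad; case v0 : (v ord0) => // vt; rewrite /delta.
by case: eqP => // e; rewrite (top_of_tail v0 e) eqxx in vt.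
Qed.

Lemma transport_unique x y x' y1 y2 :
  transport x y x' y1 -> transport x y x' y2 -> y1 = y2.
Proof.
move=> c1 c2; have /nstepE/(_ n.+1 (leqnn _))[inj _] := stepn.
rewrite -(quad_top x y x' y1) -(quad_top x y x' y2).
congr (_ (top_vertex _)); apply: inj => // v; exact: quad_neq_top.
Qed.

(** Off the top vertex, [quad] consists of [delta x y] and of degenerate
    1-cubes, so it is a corner whatever [y'] is. *)
Lemma transport_exists x y x' : cube D n (delta x y) ->
  exists y', transport x y x' y'.
Proof.
move=> cd; have /nstepE/(_ n.+1 (leqnn _))[_ sur] := stepn.
have [i|h ch hE] := sur (quad x y x' x').
  case: (unliftP ord0 i) => [j|] ->.
    apply: (cube_face (cube_morphism_upd (lift ord0 j) false)
      (cube_edge ord0 x x')) => v.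
    have vt : tail (upd (lift ord0 j) false v) != top_vertex n.
      by apply/neq_topP; exists j; rewrite !ffunE eqxx.
    by rewrite /= /quad /delta; case: (upd _ _ _ ord0); rewrite /= (negbTE vt).
  apply: (cube_face (@cube_morphism_face_proj n.+1 ord0) cd) => v.
  rewrite /= /quad ffunE eqxx; congr delta.
  by apply/ffunP => k; rewrite !ffunE.
exists (h (top_vertex _)).
apply: (cube_face (@cube_morphism_id _) ch) => v.
have [->|vt] := eqVneq v (top_vertex n.+1); first by rewrite quad_top.
by rewrite /= [RHS]hE //; exact: quad_neq_top.
Qed.

End Quad.

Section Filler.
Variables (T : Type) (D : cubeset T) (k : nat).
Hypotheses (fib : fibrant D) (conn : forall x y, trunc_rel 0 D x y).

(** The cube prescribed by the multiplication of homotopy groups: it is [e]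
    off the square where the coordinates after the first two are 1, and there
    it takes the values e, a, b, z. *)
Definition corner_filler (e a b z : T) (v : vertex k.+2) : T :=
  if on_top [seq i : 'I_k.+2 <- enum 'I_k.+2 | 1 < i] v
  then quad e a b z v else e.

Let one : 'I_k.+2 := lift ord0 ord0.

Lemma on_top_rest (v : vertex k.+2) :
  reflect (forall i : 'I_k.+2, 1 < i -> v i)
    (on_top [seq i : 'I_k.+2 <- enum 'I_k.+2 | 1 < i] v).
Proof.
apply: (iffP allP) => H i.
  by move=> i1; apply: H; rewrite mem_filter i1 mem_enum.
by rewrite mem_filter => /andP[/H].
Qed.

Lemma face_proj_one_top (v : vertex k.+2) :
  (face_proj one v == top_vertex k.+1) =
  v ord0 && on_top [seq i : 'I_k.+2 <- enum 'I_k.+2 | 1 < i] v.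
Proof.
apply/eqP/andP => [/ffunP vt|[v0 /on_top_rest vr]].
  have vl i : v (lift one i) by have := vt i; rewrite !ffunE.
  split; first by have := vl ord0; congr (is_true (v _)); exact: val_inj.
  by apply/on_top_rest => i; case: (unliftP one i) => [j|] ->.
apply/ffunP => i; rewrite !ffunE.
case: (posnP i) => [i0|i0]; last first.
  by apply: vr; rewrite /= /bump; case: (i : nat) i0.
by rewrite (_ : lift one i = ord0)//; apply: val_inj; rewrite /= /bump i0.
Qed.

(** [quad e a b z] is [b] rather than [e] on most of its second facet.  On the
    square where the later coordinates are 1 it has the right values, and off
    that square it agrees with the 1-cube from [e] to [b]; so it can be moved
    onto the degenerate cube of [delta e b], which is constant off the square.
*)
Lemma cube_corner_filler e a b z : cube D k.+1 (delta e b) ->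
  cube D k.+2 (quad e a b z) -> cube D k.+2 (corner_filler e a b z).
Proof.
move=> cb cq.
have ch := cube_comp (@cube_morphism_face_proj k.+2 one) cb.
have cr := cube_replace fib (cube_edge fib conn ord0 e b) cq ch.
apply: (cube_face (@cube_morphism_id _)
   (cr [seq i : 'I_k.+2 <- enum 'I_k.+2 | 1 < i] _ _)) => v.
- move=> vJ; have vt : face_proj ord0 v != top_vertex k.+1.
    apply: contra vJ => /eqP/ffunP vt; apply/on_top_rest => i.
    by case: (unliftP ord0 i) => [j|] -> // _; have := vt j; rewrite !ffunE.
  by rewrite /quad /delta; case: (v ord0); rewrite /= (negbTE vt).
- by move=> vJ; rewrite /= /delta face_proj_one_top vJ andbT.
- rewrite /corner_filler; case: ifP => // vJ.
  by rewrite /= /delta face_proj_one_top vJ andbF.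
Qed.

Lemma corner_filler_eps (e a b z : T) (i : 'I_k.+2) w :
  corner_filler e a b z (eps i w) =
  if i == 0 :> nat then delta e a w
  else if i == 1 :> nat then delta e b w else e.
Proof.
have epsi : eps i w i = false by rewrite ffunE unlift_none.
rewrite /corner_filler.
case: ifP => [/on_top_rest vr|vr].
  case: (posnP i) => [i0|i0].
    have ei : i = ord0 by exact: val_inj.
    by rewrite {}ei in epsi *; rewrite /quad epsi tail_eps.
  case: eqP => [i1|i1]; last first.
    have : eps i w i; last by rewrite epsi.
    by apply: vr; rewrite ltn_neqAle eq_sym i0 andbT; exact/eqP.
  have ei : i = one by exact: val_inj.
  rewrite {}ei in epsi vr *.
  have vt : face_proj ord0 (eps one w) != top_vertex k.+1.
    by apply/neq_topP; exists ord0; rewrite ffunE epsi.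
  have -> : quad e a b z (eps one w) = if eps one w ord0 then b else e.
    by rewrite /quad /delta; case: (eps one w ord0); rewrite /= (negbTE vt).
  have we : face_proj one (eps one w) = w.
    by apply/ffunP => j; rewrite !ffunE liftK.
  rewrite -[in RHS]we /delta face_proj_one_top.
  by have /on_top_rest -> := vr; rewrite andbT.
case: (posnP i) => [i0|i0].
  have ei : i = ord0 by exact: val_inj.
  rewrite /delta; case: eqP => // wt.
  case/negP: (negbT vr); apply/on_top_rest => j.
  by case: (unliftP i j) => [l ->|->]; rewrite ?ei // !ffunE liftK wt ffunE.
case: eqP => [i1|//].
have ei : i = one by exact: val_inj.
have we : face_proj one (eps one w) = w.
  by apply/ffunP => j; rewrite !ffunE liftK.
by rewrite ei in vr; rewrite -we /delta face_proj_one_top vr andbF.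
Qed.

Lemma corner_filler_dup (e a b z : T) w :
  corner_filler e a b z (dup_first w) = delta e z w.
Proof.
rewrite /corner_filler /delta; case: eqVneq => [->|wt].
  have -> : dup_first (top_vertex k.+1) = top_vertex k.+2.
    by apply/ffunP => i; rewrite !ffunE.
  by rewrite quad_top; case: on_top_rest => // -[] i; rewrite ffunE.
case: on_top_rest => // vr.
have w0 : w ord0 = false.
  apply/negbTE; move: wt; apply: contraNN => w0; apply/eqP/ffunP => i.
  rewrite ffunE; case: (posnP i) => [i0|i0].
    by rewrite (_ : i = ord0)//; exact: val_inj.
  have := vr (lift ord0 i); rewrite ffunE /= /bump leq0n add1n ltnS.
  by rewrite inord_val; apply.
have in0 : inord 0 = ord0 :> 'I_k.+1 by apply: val_inj; rewrite /= inordK.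
rewrite /quad !ffunE /= in0 w0 /delta.
rewrite (_ : (_ == _) = false)//; apply/negbTE/neq_topP; exists ord0.
by rewrite !ffunE /= in0 w0.
Qed.

End Filler.

Local Open Scope classical_set_scope.

(** * Compact spaces *)

(** Projections along a compact factor are closed maps (tube lemma). *)
Lemma closed_image_fst (S K : topologicalType) (A : set (S * K)) :
  compact [set: K] -> closed A -> closed [set s | exists k, A (s, k)].
Proof.
move=> /compact_near_coveringP cK cA; rewrite -openC openE => s sA.
have := cK S (nbhs s) (fun s k => ~ A (s, k)) _ _.
rewrite /interior => H; apply: filterS (H _ _).
- by move=> t tA [k Atk]; exact: tA Atk.
- move=> k _; have : nbhs (s, k) (~` A).
    apply: open_nbhs_nbhs; split; first by rewrite openC.
    by move=> Ask; apply: sA; exists k.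
  move=> [[U V] [/= nU nV] UVA]; exists (V, U) => // -[k' s'] [/= Vk Us] Ask.
  by apply: (UVA (s', k')).
Qed.

Lemma closed_graph_continuous (S K : topologicalType) (f : S -> K)
    (G : set (S * K)) :
  compact [set: K] -> closed G -> (forall s k, G (s, k) <-> f s = k) ->
  continuous f.
Proof.
move=> cK cG GE; apply/continuous_closedP => F cF.
rewrite (_ : f @^-1` F = [set s | exists k, (G `&` (snd @^-1` F)) (s, k)]).
  apply: closed_image_fst => //; apply: closedI => //.
  by apply: preimage_closed => // x _; exact: cvg_snd.
apply/seteqP; split=> s /=.
  by move=> Fs; exists (f s); split => //; exact/GE.
by move=> [k [/GE <-]].
Qed.

Lemma ptws_continuous (S T : topologicalType) (I : eqType)
    (f : S -> {ptws I -> T}) :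
  (forall i, continuous (fun s => f s i)) -> continuous f.
Proof.
move=> cf s; apply/cvg_sup => i; apply/cvg_image.
  by rewrite eqEsubset; split => // t _; exists (fun=> t).
move=> A /(cf i s) nA; exists [set g : {ptws I -> T} | A (g i)] => //.
by apply/seteqP; split => [_ [g Ag <-]//|t At]; exists (fun=> t).
Qed.

Lemma eval_continuous (T : topologicalType) (I : eqType) (i : I) :
  continuous (fun g : {ptws I -> T} => g i).
Proof. exact: (@proj_continuous I (fun=> T)). Qed.

Section ClosedQuotient.
Variables (X Y : topologicalType) (p : X -> Y).
Hypotheses (pc : continuous p) (psurj : forall y, exists x, p x = y).
Hypothesis pclosed : forall F, closed F -> closed (p @` F).

(** The points whose fibres lie in [U], written so that openness for open [U]
    is visible from closedness of [p]. *)
Definition saturated_interior (U : set X) : set Y := ~` (p @` (~` U)).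

Lemma saturated_interiorE U y :
  saturated_interior U y <-> forall x, p x = y -> U x.
Proof.
split=> [yU x xy|yU [x nU xy]]; last exact/nU/yU.
by apply: contrapT => nU; apply: yU; exists x.
Qed.

Lemma open_saturated_interior U : open U -> open (saturated_interior U).
Proof. by move=> oU; rewrite openC; apply: pclosed; rewrite closedC. Qed.

(** Fibres are disjoint closed sets, hence separated by normality; saturated
    interiors bring the separation down. *)
Lemma closed_quotient_hausdorff : compact [set: X] -> hausdorff_space X ->
  hausdorff_space Y.
Proof.
move=> cX hX; have nX := compact_normal hX cX.
have cF y : closed (p @^-1` [set y]).
  have [x <-] := psurj y; apply: (proj1 (continuous_closedP p) pc).
  rewrite (_ : [set p x] = p @` [set x]); last by rewrite image_set1.
  exact/pclosed/accessible_closed_set1/hausdorff_accessible.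
rewrite open_hausdorff => y z yz.
have [U /set_nbhsP[V [oV yV VU]] Uz] : filter_from (set_nbhs (p @^-1` [set y]))
    closure (~` (p @^-1` [set z])).
  apply: nX => //; apply/set_nbhsP; exists (~` (p @^-1` [set z])); split => //.
    by rewrite openC.
  by move=> x /= ->; exact/eqP.
exists (saturated_interior V, saturated_interior (~` closure U)); split => /=.
- by apply/mem_set/saturated_interiorE => x xy; exact: yV.
- by apply/mem_set/saturated_interiorE => x xz /Uz.
- exact: open_saturated_interior.
- by apply: open_saturated_interior; rewrite openC; exact: closed_closure.
apply/eqP/seteqP; split => // w.
move=> [/saturated_interiorE w1 /saturated_interiorE w2].
have [x xw] := psurj w; have /VU/subset_closure := w1 x xw; exact: w2.
Qed.

(** Saturated interiors of finite unions of basic open sets form a basis,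
    because fibres are compact. *)
Lemma closed_quotient_second_countable : compact [set: X] ->
  hausdorff_space Y -> @second_countable X -> @second_countable Y.
Proof.
move=> cX hY [B /countable_injP[f finj] [Bo Bb]].
(* an enumeration of the basis: [e n] is its n-th member, or empty *)
pose e n := \bigcup_(b in [set b | B b /\ f b = n]) b.
have eo n : open (e n) by apply: bigcup_open => b [/Bo].
have ef b : B b -> e (f b) = b.
  move=> Bbb; apply/seteqP; split => [x [b' [Bb' fb]]|x bx]; last by exists b.
  by rewrite (finj b' b) // inE.
pose V (s : {fset nat}) := saturated_interior (\bigcup_(i in [set` s]) e i).
exists (range V); first exact: sub_countable (card_image_le _ _) (countableP _).
have {}Vo s : open (V s).
  by apply: open_saturated_interior; apply: bigcup_open.
split=> [_ [s _ <-]//|y W]; rewrite nbhsE => -[O [oO Oy OW]].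
have [x0 x0y] := psurj y.
pose Xp : ptopologicalType :=
  HB.pack (X : Type) (isPointed.Build X x0) (Topological.on X).
have cy : @cover_compact Xp (p @^-1` [set y]).
  rewrite -compact_cover; apply: (@subclosed_compact X _ setT) => //.
  apply: (proj1 (continuous_closedP p) pc).
  exact/accessible_closed_set1/hausdorff_accessible.
have [x /= xy|D Dsub Dcov] :=
  cy nat [set n | e n `<=` p @^-1` O] e (fun i _ => eo i).
  have : nbhs x (p @^-1` O).
    by apply: pc; rewrite xy; exact: open_nbhs_nbhs.
  move=> /(Bb x)[b [Bbb bx] bO]; exists (f b); rewrite /= ef //.
exists (V D) => //=; first split; first by exists D.
  by apply/saturated_interiorE => x xy; apply: Dcov.
move=> z /saturated_interiorE zD; apply: OW.
have [x xz] := psurj z; have [i Di eix] := zD x xz.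
by have := Dsub i Di; rewrite inE => /(_ _ eix); rewrite /= xz.
Qed.

End ClosedQuotient.

Lemma compact_continuous_closed (X Y : topologicalType) (f : X -> Y) F :
  compact [set: X] -> hausdorff_space Y -> continuous f -> closed F ->
  closed (f @` F).
Proof.
move=> cX hY fc cF; apply: compact_closed => //; apply: continuous_compact.
  exact: continuous_subspaceT.
exact: subclosed_compact cF cX _.
Qed.

(** An injective continuous map from a compact space to a Hausdorff space is
    closed, so [K] carries the topology induced by [f]. *)
Lemma embedding_compact_space (K Y : topologicalType) (f : K -> Y) :
  compact [set: K] -> compact_space Y -> continuous f -> injective f ->
  compact_space K.
Proof.
move=> cK [_ hY [B Bc [Bo Bb]]] fc finj.
have fopen (U : set K) k : open U -> U k ->
    exists b, [/\ B b, b (f k) & f @^-1` b `<=` U].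
  move=> oU Uk; have : nbhs (f k) (~` (f @` (~` U))).
    apply: open_nbhs_nbhs; split; last first.
      by move=> [k' Uk' /finj e]; rewrite e in Uk'.
    by rewrite openC; apply: compact_continuous_closed => //; rewrite closedC.
  move=> /Bb[b [Bbb bk] bU]; exists b; split => // k' /bU Uk'.
  by apply: contrapT => nU; apply: Uk'; exists k'.
split => //.
- rewrite open_hausdorff in hY; rewrite open_hausdorff => x y xy.
  have fxy : f x != f y by apply: contra xy => /eqP/finj ->.
  have [[U V] /= [xU yV] [oU oV UV]] := hY _ _ fxy.
  exists (f @^-1` U, f @^-1` V) => /=; first by rewrite !inE in xU yV *.
  split; [exact: (proj1 (continuousP f) fc)|exact: (proj1 (continuousP f) fc)|].
  by rewrite -preimage_setI (eqP UV) preimage_set0.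
- exists [set f @^-1` b | b in B].
    exact: sub_countable (card_image_le _ _) Bc.
  split=> [_ [b Bbb <-]|k W].
    exact: (proj1 (continuousP f) fc) (Bo _ Bbb).
  rewrite nbhsE => -[O [oO Ok] OW]; have [b [Bbb bk bO]] := fopen _ _ oO Ok.
  exists (f @^-1` b); first by split => //; exists b.
  exact: subset_trans OW.
Qed.

(** * Compact truncations *)

Section CompactTrunc.
Variables (X : topologicalType) (C : cubeset X).
Hypothesis CC : compact_nilspace C.

Let fib : fibrant C. Proof. by case: CC => -[]. Qed.
Let cX : compact [set: X]. Proof. by case: CC => _ []. Qed.
Let hX : hausdorff_space X. Proof. by case: CC => _ []. Qed.
Let sX : @second_countable X. Proof. by case: CC => _ []. Qed.

(** By [trunc_relE] this is the preimage of the closed set of (n+1)-cubes. *)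
Lemma closed_trunc_rel n : closed [set xy : X * X | trunc_rel n C xy.1 xy.2].
Proof.
rewrite (_ : [set _ | _] =
  (fun xy : X * X => delta xy.1 xy.2 : {ptws vertex n.+1 -> X})
    @^-1` (cube C n.+1)); last first.
  by apply/seteqP; split => xy /= /(trunc_relE fib).
apply: (proj1 (continuous_closedP _)); last by case: CC.
apply: ptws_continuous => v; rewrite /delta.
by case: eqP => _ xy; [exact: cvg_snd|exact: cvg_fst].
Qed.

Lemma trunc_proj_continuous n : continuous (trunc_proj n C).
Proof. exact: pi_continuous. Qed.

(** The saturation of [F] is the projection to X of a closed subset of the
    graph of ~_n. *)
Lemma trunc_proj_closed n F : closed F -> closed (trunc_proj n C @` F).
Proof.
move=> cF; rewrite -openC.
suff cpF : closed (trunc_proj n C @^-1` (trunc_proj n C @` F)).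
  exact: (closed_openC cpF).
rewrite (_ : _ @^-1` _ = [set x | exists y,
    ([set xy : X * X | trunc_rel n C xy.1 xy.2] `&` snd @^-1` F) (x, y)]).
  apply: closed_image_fst => //; apply: closedI; first exact: closed_trunc_rel.
  by apply: (proj1 (continuous_closedP _)) => // xy; exact: cvg_snd.
apply/seteqP; split => x /=.
  move=> [y Fy /(trunc_projE fib) yx].
  by exists y; split => //; exact: trunc_rel_sym.
by move=> [y [xy Fy]]; exists y => //; exact/(trunc_projE fib)/trunc_rel_sym.
Qed.

Lemma compact_trunc n : compact_space (trunc n C).
Proof.
have hY := closed_quotient_hausdorff (@trunc_proj_continuous n)
  (@trunc_proj_surj _ C n) (@trunc_proj_closed n) cX hX.
split => //; last exact: (closed_quotient_second_countable
  (@trunc_proj_continuous n) (@trunc_proj_surj _ C n) (@trunc_proj_closed n)).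
rewrite (_ : setT = trunc_proj n C @` setT).
  apply: continuous_compact => //.
  by apply: continuous_subspaceT; exact: trunc_proj_continuous.
apply/seteqP; split => // t _; have [x <-] := trunc_proj_surj t.
by exists x.
Qed.

(** The cubes of the truncation are the continuous image of the compact set of
    cubes of [C]. *)
Lemma closed_Trunc n m :
  closed (cube (Trunc n C) m : set {ptws vertex m -> trunc n C}).
Proof.
have [_ hY _] := compact_trunc n.
rewrite (_ : cube _ _ = (fun c : {ptws vertex m -> X} =>
   trunc_proj n C \o c : {ptws vertex m -> trunc n C}) @` cube C m).
  apply: compact_closed; first exact: hausdorff_product.
  apply: (@continuous_compact
    {ptws vertex m -> X} {ptws vertex m -> trunc n C}).
    apply: continuous_subspaceT; apply: ptws_continuous => v c.
    apply: continuous_comp; last exact: trunc_proj_continuous.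
    exact: eval_continuous.
  apply: (subclosed_compact _ (tychonoff (fun _ : vertex m => cX))) => //.
  by case: CC => _ _ /(_ m).
apply/seteqP; split => c /=; first by move=> [c0 [cc0 ->]]; exists c0.
by move=> [c0 cc0 <-]; exact: Trunc_cube_proj.
Qed.

Lemma compact_nilspace_Trunc n : compact_nilspace (Trunc n C).
Proof.
split; [split|exact: compact_trunc|exact: closed_Trunc].
  exact: fibrant_Trunc.
by exists n; exact: nstep_Trunc.
Qed.

Lemma trunc_down_continuous n : continuous (@trunc_down X C n).
Proof.
apply/quotient_continuous.
rewrite (_ : _ \o _ = trunc_proj n C); first exact: trunc_proj_continuous.
by apply/funext => x; exact: trunc_down_proj.
Qed.

Lemma surjective_fibration_trunc_proj n :
  surjective_fibration C (Trunc n C) (trunc_proj n C).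
Proof.
split; [exact: trunc_proj_continuous| |exact: fibration_trunc_proj].
by move=> t _; have [x <-] := trunc_proj_surj t; exists x.
Qed.

Lemma surjective_fibration_trunc_down n :
  surjective_fibration (Trunc n.+1 C) (Trunc n C) (@trunc_down X C n).
Proof.
split; [exact: trunc_down_continuous| |exact: fibration_trunc_down].
move=> t _; have [x <-] := trunc_proj_surj t.
by exists (trunc_proj n.+1 C x); rewrite ?trunc_down_proj.
Qed.

End CompactTrunc.

(** * Homotopy groups and their actions *)

Lemma compact_set_type (T : topologicalType) (A : set T) :
  compact A -> compact [set: A].
Proof.
move=> cA F PF _.
have [|p [Ap pF]] := cA (set_val @ F) _.
  rewrite /fmap /=; apply: filterS filterT => a _; exact: set_valP.
exists (SigSub (mem_set Ap)); split => // B N FB; rewrite nbhsE.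
move=> [O [[V oV <-] OaV] OV].
have [_ [[b Bb <-] Vb]] : set_val @` B `&` V !=set0.
  apply: pF; last first.
    by apply: open_nbhs_nbhs; split => //; move: OaV; rewrite /= set_valE.
  by rewrite /fmap /=; apply: filterS FB => b Bb; exists b.
by exists b; split => //; exact: OV.
Qed.

Lemma fst_fst_continuous (S T U : topologicalType) :
  continuous (fun z : (S * T) * U => z.1.1).
Proof. by move=> z; apply: continuous_comp; exact: cvg_fst. Qed.

Lemma fst_snd_continuous (S T U : topologicalType) :
  continuous (fun z : (S * T) * U => z.1.2).
Proof.
by move=> z; apply: continuous_comp; [exact: cvg_fst|exact: cvg_snd].
Qed.

Section HomotopyGroup.
Variables (X : topologicalType) (C : cubeset X) (k : nat) (x0 : X).
Hypotheses (CC : compact_nilspace C) (erg : ergodic C).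

Let fib : fibrant C. Proof. by case: CC => -[]. Qed.

Notation n := k.+1.
Notation Y := (trunc n C).
Notation D := (Trunc n C).
Notation e := (trunc_proj n C x0).
Notation G := (pi_space C n x0).
Notation transport x y x' y' := (cube D n.+1 (quad x y x' y')).

Let fibD : fibrant D. Proof. exact: fibrant_Trunc. Qed.
Let stepD : nstep n D. Proof. exact: nstep_Trunc. Qed.

(** Two points of the 0-truncation are two of its 0-cubes. *)
Lemma trunc0_eq (s t : trunc 0 C) : s = t.
Proof.
have [c [_ c_unique]] := erg 0.
have cE u : c = fun=> u by apply: c_unique; exact: cube_point.
by have := congr1 (@^~ (vzero 0)) (etrans (esym (cE s)) (cE t)).
Qed.

(** By ergodicity every pair of points is a 1-cube. *)
Let conn x y : trunc_rel 0 D x y.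
Proof.
have [a <-] := trunc_proj_surj x; have [b <-] := trunc_proj_surj y.
have /(trunc_relE fib) cd : trunc_rel 0 C a b.
  by apply/(trunc_projE fib); exact: trunc0_eq.
apply/(trunc_relE fibD); exists (delta a b); split => //.
by apply/funext => v; rewrite /= /delta; case: ifP.
Qed.

(** Elements of the homotopy group are constant off the top vertex, so [tip]
    identifies the group with the fibre of [e]. *)
Definition tip (a : G) : Y := pi_val a (top_vertex n).

Lemma pi_valE a : pi_val a = delta e (tip a).
Proof.
have /set_mem[_ aE] := valP a; apply/funext => v; rewrite /delta.
by case: eqVneq => [->//|vt]; exact: (aE (corner_of vt)).
Qed.

Lemma cube_tip a : cube D n (delta e (tip a)).
Proof. by rewrite -pi_valE; have /set_mem[] := valP a. Qed.

Lemma tip_inj : injective tip.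
Proof.
by move=> a b ab; apply: val_inj; have := pi_valE a; rewrite ab -pi_valE.
Qed.

Lemma tip_surj y : cube D n (delta e y) -> exists a, tip a = y.
Proof.
move=> cy; have dy : @pi_set X C n x0 (delta e y).
  by split => // v; rewrite /delta (negbTE (corner_neq_top v)).
exists (SigSub (mem_set dy)); rewrite /tip /pi_val set_valE /=.
by rewrite /delta eqxx.
Qed.

Lemma tip_continuous : continuous tip.
Proof.
move=> a; apply: (@continuous_comp _ {ptws vertex n -> Y} _ set_val
  (fun c => c (top_vertex n))).
  exact: initial_continuous.
exact: eval_continuous.
Qed.

Lemma continuous_tip (S : topologicalType) (f : S -> G) :
  continuous f -> continuous (fun s => tip (f s)).
Proof.
by move=> cf s; exact: continuous_comp (cf s) (@tip_continuous (f s)).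
Qed.

Lemma compact_pi_space : compact_space G.
Proof.
have [_ cY cD] := compact_nilspace_Trunc CC n.
have [cptY hY _] := cY.
apply: (embedding_compact_space _ cY tip_continuous tip_inj).
apply: compact_set_type.
apply: (subclosed_compact _ (tychonoff (fun _ : vertex n => cptY))) => //.
rewrite (_ : @pi_set X C n x0 = cube D n `&`
  \bigcap_(v in [set: corner n])
    (fun c : {ptws vertex n -> Y} => c (val v)) @^-1` [set e]).
  apply: closedI; first exact: cD.
  apply: closed_bigI => v _; apply: (proj1 (continuous_closedP _)).
    exact: eval_continuous.
  exact/accessible_closed_set1/hausdorff_accessible.
by apply/seteqP; split => c [cc cE]; split => // v; [move=> _|]; exact: cE.
Qed.

(** The source of all continuity below: graphs of maps defined by transport are
    closed. *)
Lemma closed_transport (S : topologicalType) (f1 f2 f3 f4 : S -> Y) :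
  continuous f1 -> continuous f2 -> continuous f3 -> continuous f4 ->
  closed [set s | transport (f1 s) (f2 s) (f3 s) (f4 s)].
Proof.
move=> c1 c2 c3 c4; have [_ _ cD] := compact_nilspace_Trunc CC n.
apply: (proj1 (continuous_closedP (fun s => quad (f1 s) (f2 s) (f3 s) (f4 s)
  : {ptws vertex n.+1 -> Y})) _ _ (cD n.+1)).
apply: ptws_continuous => v; rewrite /quad /delta.
by case: (v ord0); case: eqP.
Qed.

(** [act g s] is the transport of [tip g] when [e] is moved to [s], and the
    product of [g] and [h] is the element with tip [act g (tip h)]. *)
Lemma homotopy_group_action : exists L : group_law G,
  [/\ pi_group_law L, topological_group L, compact_space G &
    exists act : G -> Y -> Y,
      [/\ continuous_action L act, free_action L act &
          orbits_are_fibers act (@trunc_down X C k)]].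
Proof.
have hrefl := @transport_hrefl _ D n.
have hsym := @transport_hsym _ D n.
have htrans := @transport_htrans _ D n fibD.
have vrefl := @transport_vrefl _ D n fibD conn.
have vsym := @transport_vsym _ D n fibD conn.
have vtrans := @transport_vtrans _ D n fibD conn.
have uniq := @transport_unique _ D n stepD.
have fill := @transport_exists _ D n fibD stepD conn.
have tgt := @transport_target _ D n.
have /choice[act' actP'] : forall gs : G * Y,
    exists t, transport e (tip gs.1) gs.2 t.
  by move=> gs; exact: fill (cube_tip _).
pose act g s := act' (g, s).
have actP g s : transport e (tip g) s (act g s) := actP' (g, s).
have actE g s t : transport e (tip g) s t <-> act g s = t.
  by split => [|<-//]; exact: uniq.
have /choice[mul' mulP'] : forall ab : G * G,
    exists c, tip c = act ab.1 (tip ab.2).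
  move=> [a b]; apply: tip_surj => /=.
  have /tgt cab := actP a (tip b).
  apply/(trunc_relE fibD); apply: (trunc_rel_trans fibD (y := tip b)).
    by apply/(trunc_relE fibD)/cube_tip.
  exact/(trunc_relE fibD).
pose mul a b := mul' (a, b).
have mulP a b : tip (mul a b) = act a (tip b) := mulP' (a, b).
have /choice[inv invP] : forall a, exists b, transport (tip a) e e (tip b).
  move=> a; have [|y ty] := fill (tip a) e e.
    exact/(trunc_relE fibD)/trunc_rel_sym/(trunc_relE fibD)/cube_tip.
  by have [b bE] := tip_surj (tgt _ _ _ _ ty); exists b; rewrite bE.
have [one oneP] : exists a, tip a = e.
  by apply: tip_surj; exact: (tgt _ _ _ _ (vrefl e e)).
have act1 s : act one s = s by apply/actE; rewrite oneP; exact: vrefl.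
(* moving [g] from [tip h] to [act h s], on top of moving [h] from [e] to [s] *)
have actM g h s : act (mul g h) s = act g (act h s).
  apply/actE; rewrite mulP; apply: vtrans (actP h s) _.
  exact: htrans (hsym _ _ _ _ (actP g (tip h))) (actP g (act h s)).
have actV a : act a (tip (inv a)) = e by apply/actE/vsym/invP.
have actV' a : act (inv a) (tip a) = e by apply/actE/hsym/invP.
have mulA : associative mul by move=> a b c; apply: tip_inj; rewrite !mulP actM.
have mul1l : left_id one mul by move=> a; apply: tip_inj; rewrite mulP act1.
have mul1r : right_id one mul.
  by move=> a; apply: tip_inj; rewrite mulP oneP; apply/actE/hrefl/cube_tip.
have mulVl : left_inverse one inv mul.
  by move=> a; apply: tip_inj; rewrite mulP actV' oneP.
have mulVr : right_inverse one inv mul.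
  by move=> a; apply: tip_inj; rewrite mulP actV oneP.
have [_ cY _] := compact_nilspace_Trunc CC n; have [cptY _ _] := cY.
have cG := compact_pi_space; have [cptG _ _] := cG.
exists (GroupLaw mulA mul1l mul1r mulVl mulVr); split => //.
- move=> a b /=.
  exists (corner_filler e (tip a) (tip b) (tip (mul a b))); split.
    have cf : pi_filler a b (corner_filler e (tip a) (tip b) (tip (mul a b))).
      split; last by move=> i w; rewrite corner_filler_eps !pi_valE.
      apply: cube_corner_filler => //; first exact: cube_tip.
      by rewrite mulP; exact: actP.
    split => // d [cd dE]; have /nstepE/(_ n.+1 (leqnn _))[inj _] := stepD.
    apply: inj => // [|v /neq_topP[i vi]]; first by case: cf.
    have -> : v = eps i (face_proj i v).
      by rewrite eps_face_proj upd_id//; exact/negbTE.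
    by rewrite dE; case: cf => _ ->.
  by rewrite pi_valE; apply/funext => w; rewrite /= corner_filler_dup.
- split => /=.
    apply: (@closed_graph_continuous _ _ _
      [set z : (G * G) * G |
        transport e (tip z.1.1) (tip z.1.2) (tip z.2)]) => //.
      apply: closed_transport.
      + exact: cst_continuous.
      + exact/continuous_tip/fst_fst_continuous.
      + exact/continuous_tip/fst_snd_continuous.
      + by apply: continuous_tip => z; exact: cvg_snd.
    move=> [a b] c; apply: (iff_trans (actE _ _ _)); rewrite -mulP /=.
    by split => [/tip_inj//|->].
  apply: (@closed_graph_continuous _ _ _
    [set z : G * G | transport (tip z.1) e e (tip z.2)]) => //.
    apply: closed_transport.
    + by apply: continuous_tip => z; exact: cvg_fst.
    + exact: cst_continuous.
    + exact: cst_continuous.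
    + by apply: continuous_tip => z; exact: cvg_snd.
  move=> a b /=; split => [ab|<-]; last exact: invP.
  exact/tip_inj/(uniq _ _ _ _ _ (invP a) ab).
exists act; split.
- split => //=.
  apply: (@closed_graph_continuous _ _ _
    [set z : (G * Y) * Y | transport e (tip z.1.1) z.1.2 z.2]) => //.
    apply: closed_transport.
    + exact: cst_continuous.
    + exact/continuous_tip/fst_fst_continuous.
    + exact: fst_snd_continuous.
    + by move=> z; exact: cvg_snd.
  by move=> [g s] t; exact: actE.
- move=> g s /actE gs; apply: tip_inj; rewrite /= oneP.
  exact: uniq (hsym _ _ _ _ gs) (vrefl s e).
- move=> s; apply/seteqP; split => t /=.
    move=> [g _ <-]; apply/(trunc_down_eq fib)/trunc_rel_sym/(trunc_relE fibD).
    exact: (tgt _ _ _ _ (actP g s)).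
  move=> ts; have /(trunc_relE fibD) st : trunc_rel k D s t.
    exact/trunc_rel_sym/(trunc_down_eq fib).
  have [y ty] := fill _ _ e st.
  have [g gE] := tip_surj (tgt _ _ _ _ ty); exists g => //.
  by apply/actE; rewrite gE; exact: hsym.
Qed.

End HomotopyGroup.

Theorem mainTheorem1 (X : topologicalType) (C : cubeset X)
    (C_compact : compact_nilspace C) (C_ergodic : ergodic C) :
  exists p : forall n : nat, trunc n.+1 C -> trunc n C,
  [/\ forall n : nat,
        compact_nilspace (Trunc n C) /\ nstep n (Trunc n C),
      forall n : nat, surjective_fibration C (Trunc n C) (trunc_proj n C),
      forall n : nat,
        surjective_fibration (Trunc n.+1 C) (Trunc n C) (p n) /\
        (forall x : X, p n (trunc_proj n.+1 C x) = trunc_proj n C x) &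
      forall (k : nat) (x0 : X),
        exists L : group_law (pi_space C k.+1 x0),
        [/\ pi_group_law L, topological_group L,
            compact_space (pi_space C k.+1 x0) &
            exists act : pi_space C k.+1 x0 -> trunc k.+1 C -> trunc k.+1 C,
              [/\ continuous_action L act, free_action L act &
                  orbits_are_fibers act (p k)]]].
Proof.
have fib : fibrant C by case: C_compact => -[].
exists (@trunc_down X C); split=> [n|n|n|k x0].
- by split; [exact: compact_nilspace_Trunc|exact: nstep_Trunc].
- exact: surjective_fibration_trunc_proj.
- by split; [exact: surjective_fibration_trunc_down|exact: trunc_down_proj].
- exact: homotopy_group_action.
Qed.
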